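(* Let $\mathcal{H}$ be a complex Hilbert space. For $T\in\mathcal{B}(\mathcal{H})$ the following statements are equivalent: (i) $T$ has a $2$-isometric lifting of type I on a Hilbert space containing $\mathcal{H}$; (ii) $T$ is either an $A$-isometry for a positive operator $A\neq0$ on $\mathcal{H}$ with $\Delta_T\le A$, or $T$ is a strongly stable contraction; (iii) $T$ has an extension $\widetilde{T}$ on a Hilbert space $\mathcal{M}\supset\mathcal{H}$ of the form $$\widetilde{T}=\begin{pmatrix}C&\delta E\\0&U\end{pmatrix}$$ on an orthogonal decomposition $\mathcal{M}=\mathcal{M}_0\oplus\mathcal{M}_1$, where $C\in\mathcal{B}(\mathcal{M}_0)$ and $E\in\mathcal{B}(\mathcal{M}_1,\mathcal{M}_0)$ are contractions, $U\in\mathcal{B}(\mathcal{M}_1)$ is unitary, and $\delta$ is a positive scalar, such that there exist a Hilbert space $\mathcal{M}'$ and isometries $J_0:\mathcal{D}_C\to\mathcal{M}'$, $J_1:\mathcal{D}_E\to\mathcal{M}'$ satisfying $$D_CJ_0^*J_1D_E+C^*E=0;$$ (iv) $T$ has a $2$-isometric lifting $S$ on some $\mathcal{K}\supset\mathcal{H}$, with matrix $S=\begin{pmatrix}W&X\\0&T\end{pmatrix}$ on $\mathcal{K}=\mathcal{H}^\perp\oplus\mathcal{H}$, such that $$X^*\Delta_WX+2\,{\rm Re}(X^*W^*XT)=0.$$ Moreover, if these statements are true, then the lifting $S$ of $T$ in (i) and (iv) can be chosen minimal with ${\rm cov}(S)=\|A\|^{1/2}$ for $A$ from (ii), or with ${\rm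 cov}(S)\le\delta$ for $\delta$ from (iii).
   Context: All Hilbert spaces are complex and operators are bounded and linear. For an operator $T$, $\Delta_T=T^*T-I$, ${\rm Re}(Y)=\frac12(Y+Y^* )$, and $\mathcal{N}(\cdot)$ denotes the kernel. $S$ is a $2$-isometry if $S^{*2}S^2-2S^*S+I=0$, i.e. $S^*\Delta_SS=\Delta_S$; then $\Delta_S\ge0$ and ${\rm cov}(S)=\|\Delta_S\|^{1/2}$ is the covariance of $S$. If $\mathcal{H}$ is a closed subspace of $\mathcal{K}$, $S\in\mathcal{B}(\mathcal{K})$ is a lifting of $T\in\mathcal{B}(\mathcal{H})$ if $P_{\mathcal{H}}S=TP_{\mathcal{H}}$; equivalently $S=\begin{pmatrix}W&X\\0&T\end{pmatrix}$ on $\mathcal{K}=\mathcal{H}^\perp\oplus\mathcal{H}$ with $W=S|_{\mathcal{H}^\perp}$, $X=P_{\mathcal{H}^\perp}S|_{\mathcal{H}}$. It is minimal if $\mathcal{K}=\bigvee_{n\ge0}S^n\mathcal{H}$. $S$ is an extension of $T$ if $S\mathcal{H}\subset\mathcal{H}$ and $S|_{\mathcal{H}}=T$. (Here $\mathcal{H}$ may be identified with its image under an isometric embedding.) A $2$-isometric lifting $S$ of $T$ is of type I if $\mathcal{H}^\perp=\mathcal{K}\ominus\mathcal{H}\subset\mathcal{N}(\Delta_S)$ (equivalently, $S|_{\mathcal{H}^\perp}$ is an isometry). For $A\ge0$ on $\mathcal{H}$, $T$ is an $A$-isometry if $T^*AT=A$. A contraction $T$ is strongly stable if $\|T^nh\|\to0$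 for all $h\in\mathcal{H}$. For a contraction $C$, $D_C=(I-C^*C)^{1/2}$ is the defect operator and $\mathcal{D}_C=\overline{\mathcal{R}(D_C)}$ the defect space. *)

(* Defs.v *)
From HB Require Import structures.
From mathcomp Require Import all_boot all_order all_algebra.
From mathcomp Require Import complex.
From mathcomp Require Import all_classical all_reals all_analysis.

Set Implicit Arguments.
Unset Strict Implicit.
Unset Printing Implicit Defensive.

Import Order.TTheory GRing.Theory Num.Theory.
Import numFieldNormedType.Exports.

Local Open Scope classical_set_scope.
Local Open Scope ring_scope.
Local Open Scope complex_scope.

(* The scalar product is linear on the left and conjugate-linear on the right;
   norms take their values in R[i], as in any normedModType R[i]. *)
HB.mixin Record CompleteNormedModule_isHilbert (R : realType) H
    & CompleteNormedModule R[i] H := {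
  inner : {dot H for (@Num.conj R[i])} ;
  inner_norm : forall x : H, inner x x = `|x| ^+ 2
}.

#[short(type="hilbertType")]
HB.structure Definition Hilbert (R : realType) :=
  {H of CompleteNormedModule R[i] H & CompleteNormedModule_isHilbert R H}.

Notation "''[' x , y ]" := (inner x y) : ring_scope.

#[short(type="boundedOp")]
HB.structure Definition BoundedOp (R : realType) (H K : hilbertType R) :=
  {f of @isContinuous H K f & @GRing.Linear R[i] H K *:%R f}.

Notation "''B(' H , K )" := (boundedOp H K) : type_scope.
Notation "''B(' H )" := (boundedOp H H) : type_scope.

Section operators.
Context {R : realType}.
Implicit Types H K M : hilbertType R.

(* An operator defined on a closed subspace D of H is represented by a total
   function J : H -> K of which only the values on D matter; adj_on D J is its
   adjoint K -> D. The vector picked by [get] exists (Riesz) when J is bounded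
   and linear on D, and is unique. *)
Definition adj_on H K (D : set H) (J : H -> K) (y : K) : H :=
  get [set z | D z /\ forall x, D x -> '[J x, y] = '[x, z]].

Definition adj H K (T : H -> K) : K -> H := adj_on setT T.

Definition Delta H (T : H -> H) : H -> H := fun x => adj T (T x) - x.

Definition ReOp H (Y : H -> H) : H -> H := fun x => 2^-1 *: (Y x + adj Y x).

(* In the order of R[i], 0 <= z entails that z is real; over the complex
   numbers this makes a positive operator self-adjoint. *)
Definition positive H (A : H -> H) : Prop := forall x, 0 <= '[A x, x].

Definition op_le H (A B : H -> H) : Prop := positive (B \- A).

Definition op_norm H K (T : H -> K) : R :=
  sup [set complex.Re `|T x| | x in [set x : H | `|x| <= 1]].

Definition kernel H K (T : H -> K) : set H := [set x | T x = 0].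

Definition contraction_op H K (T : H -> K) : Prop := forall x, `|T x| <= `|x|.

Definition isometry_op H K (V : H -> K) : Prop := forall x, `|V x| = `|x|.

Definition isometry_on H K (D : set H) (J : H -> K) : Prop :=
  (forall (a : R[i]) x y, D x -> D y -> J (a *: x + y) = a *: J x + J y)
  /\ (forall x, D x -> `|J x| = `|x|).

Definition unitary_op H (U : H -> H) : Prop :=
  adj U \o U =1 idfun /\ U \o adj U =1 idfun.

Definition strongly_stable H (T : H -> H) : Prop :=
  forall h, `|iter n T h| @[n --> \oo] --> (0 : R[i]^o).

Definition A_isometry H (A T : H -> H) : Prop := adj T \o A \o T =1 A.

(* The unique positive bounded square root of a positive bounded operator. *)
Definition op_sqrt H (A : H -> H) : H -> H :=
  get [set B : H -> H |
    [/\ linear B, continuous B, positive B & B \o B =1 A]].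

Definition defect_op H K (C : H -> K) : H -> H :=
  op_sqrt (fun x => x - adj C (C x)).

Definition defect_space H K (C : H -> K) : set H :=
  closure (range (defect_op C)).

Definition orthc H (A : set H) : set H :=
  [set x | forall a, A a -> '[x, a] = 0].

Definition closed_subspace H (U : set H) : Prop :=
  [/\ U 0, (forall (a : R[i]) x y, U x -> U y -> U (a *: x + y)) & closed U].

Definition closed_span H (A : set H) : set H := smallest (@closed_subspace H) A.

(* M is the orthogonal sum of M0 and M1, identified with closed subspaces of M
   through the isometric embeddings V0 and V1. *)
Definition orth_decomp M0 M1 M (V0 : 'B(M0, M)) (V1 : 'B(M1, M)) : Prop :=
  [/\ isometry_op V0, isometry_op V1,
      (forall x y, '[V0 x, V1 y] = 0)
    & (forall m, exists x y, m = V0 x + V1 y)].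

(* S is the block matrix with rows (A, B) and (0, D) with respect to M0 (+) M1 *)
Definition upper_triangular M0 M1 M (V0 : M0 -> M) (V1 : M1 -> M) (S : M -> M)
    (A : M0 -> M0) (B : M1 -> M0) (D : M1 -> M1) : Prop :=
  forall x y, S (V0 x + V1 y) = V0 (A x + B y) + V1 (D y).

Definition two_isometry H (S : H -> H) : Prop :=
  forall x, adj S (adj S (S (S x))) - 2 *: adj S (S x) + x = 0.

Definition cov H (S : H -> H) : R := Num.sqrt (op_norm (Delta S)).

(* In the next definitions H is identified with a closed subspace of K through
   the isometry V : H -> K; the orthogonal projection of K onto H is then
   adj V : K -> H, and the orthogonal complement of H is orthc (range V). *)

Definition extension H K (V : 'B(H, K)) (T : 'B(H)) (S : 'B(K)) : Prop :=
  isometry_op V /\ S \o V =1 V \o T.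

Definition lifting H K (V : 'B(H, K)) (T : 'B(H)) (S : 'B(K)) : Prop :=
  isometry_op V /\ adj V \o S =1 T \o adj V.

Definition two_isometric_lifting H K (V : 'B(H, K)) (T : 'B(H)) (S : 'B(K)) :=
  lifting V T S /\ two_isometry S.

Definition minimal_lifting H K (V : 'B(H, K)) (S : 'B(K)) : Prop :=
  closed_span [set iter n S (V h) | n in [set: nat] & h in [set: H]] = setT.

Definition type_I H K (V : 'B(H, K)) (S : 'B(K)) : Prop :=
  orthc (range V) `<=` kernel (Delta S).

(* The matrix condition on S = (W X; 0 T) on K = H' (+) H, where H' is the
   orthogonal complement of H. *)
Definition matrix_condition H K (V : 'B(H, K)) (T : 'B(H)) (S : 'B(K)) : Prop :=
  exists (H' : hilbertType R) (V' : 'B(H', K)) (W : 'B(H')) (X : 'B(H, H')),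
  [/\ orth_decomp V' V, upper_triangular V' V S W X T
    & forall h, adj X (Delta W (X h))
        + 2 *: ReOp (adj X \o adj W \o X \o T) h = 0].

Definition dominating_A H (T A : 'B(H)) : Prop :=
  [/\ positive A, ~ A =1 \0, A_isometry A T & op_le (Delta T) A].

Definition triangular_extension H (T : 'B(H)) (delta : R) : Prop :=
  exists (M M0 M1 : hilbertType R) (V : 'B(H, M)) (T' : 'B(M))
         (V0 : 'B(M0, M)) (V1 : 'B(M1, M))
         (C : 'B(M0)) (E : 'B(M1, M0)) (U : 'B(M1)),
  [/\ extension V T T', orth_decomp V0 V1,
      upper_triangular V0 V1 T' C (fun y => delta%:C *: E y) U,
      [/\ contraction_op C, contraction_op E, unitary_op U & 0 < delta]
    & exists (M' : hilbertType R) (J0 : M0 -> M') (J1 : M1 -> M'),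
      [/\ isometry_on (defect_space C) J0, isometry_on (defect_space E) J1
        & forall y, defect_op C (adj_on (defect_space C) J0 (J1 (defect_op E y)))
                    + adj C (E y) = 0]].

End operators.

(* Main.v *)
Require Import Defs.
From HB Require Import structures.
From mathcomp Require Import all_boot all_order all_algebra.
From mathcomp Require Import complex.
From mathcomp Require Import all_classical all_reals all_analysis.
From mathcomp Require Import ring lra.

Set Implicit Arguments.
Unset Strict Implicit.
Unset Printing Implicit Defensive.

Import Order.TTheory GRing.Theory Num.Theory.
Import numFieldNormedType.Exports.

Local Open Scope classical_set_scope.
Local Open Scope ring_scope.
Local Open Scope complex_scope.

(** The whole theorem is about one object: a positive operator [A], possibly
    zero, with [T^* A T = A] and [Delta T <= A] (the predicate [dominates]). Each
    of the four conditions is equivalent to the existence of such an [A].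

    _From a lifting to_ [A]. Let [A] be the compression of [Delta S] to [H]. It is
    positive because [|S^n x|^2 = |x|^2 + n <Delta S x, x>] for a 2-isometry, and
    it dominates [Delta T] because [T] is a compression of [S]. In the type I case
    [S h] and [T h] differ by a vector that [Delta S] kills, so that
    [S^* (Delta S) S = Delta S] compresses to [T^* A T = A]
    ([type_I_dominates]). In general the difference of these two quadratic forms
    is the left-hand side of the matrix condition
    ([matrix_condition_dominates]).

    _From_ [A] _to a lifting_. Choose [X] with [X^* X = A - Delta T] and let [X]
    feed a unilateral shift placed on the orthogonal complement of [H]. The
    resulting lifting has [Delta S = V A V^*], with [V] the embedding of [H].
    This gives at once the 2-isometry, type I and the covariance, and it survives
    the restriction to the closed span of the orbit of [H], which is minimal
    ([dominates_minimal_lifting]).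

    _Strong stability_. [A = 0] is admissible exactly when [T] is a contraction;
    then either the strong limit of [T^*n T^n] is an admissible nonzero operator,
    or [T] is strongly stable ([dominates_alternative]).

    _Triangular extensions_. If [T] extends to a triangular operator, the
    compression to [H] of [delta^2] times the projection on the unitary part is
    admissible and has norm at most [delta^2] ([triangular_dominates]).
    Conversely, with [Y = A^(1/2) / delta] and [X = (I - Y^* Y)^(1/2)], embed [H]
    isometrically by [h |-> (X h, Y h)]. The identity [T^* A T = A] makes
    [Y h |-> Y T h] isometric, hence extendable to a unitary operator
    ([unitary_extension]); the inequality [Delta T <= A] makes
    [(X h, delta Y h) |-> X T h] contractive, hence extendable to a row
    contraction [(C, E)] ([douglas]), and a row contraction satisfies the coupling
    condition on the defect operators ([row_contraction_coupling]).

    The tools are Riesz representation, adjoints, square roots of positive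
    operators, contractive factorization, and two ways to make Hilbert spaces:
    closed subspaces and square-summable sequences. *)

(** * Real parts of inner products *)


Section RealParts.
Context {R : realType}.
Implicit Types H K L : hilbertType R.

(** Everything is computed with real parts: [Im <x, y> = Re <x, i y>] recovers
    the rest, and identities between reals are within reach of linear
    arithmetic. *)
Definition rip H (x y : H) : R := complex.Re '[x, y].
Definition rnorm H (x : H) : R := complex.Re `|x|.

Lemma conjE (z : R[i]) : Num.conj z = (complex.Re z -i* complex.Im z).
Proof. by case: z. Qed.

Lemma normE H (x : H) : `|x| = (rnorm x)%:C.
Proof. by rewrite /rnorm RRe_real// ger0_real. Qed.

Lemma rnorm_ge0 H (x : H) : 0 <= rnorm x.
Proof. by rewrite -ler0c -normE. Qed.

Lemma innerDl H (x y z : H) : '[x + y, z] = '[x, z] + '[y, z].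
Proof. exact: linearDl. Qed.

Lemma innerZl H (a : R[i]) (x z : H) : '[a *: x, z] = a * '[x, z].
Proof. exact: linearZl_LR. Qed.

Lemma innerC H (x y : H) : '[x, y] = Num.conj '[y, x].
Proof. by rewrite (hermitian_subproof x y) expr0 mul1r. Qed.

Lemma innerDr H (x y z : H) : '[z, x + y] = '[z, x] + '[z, y].
Proof. by rewrite innerC innerDl rmorphD /= -!innerC. Qed.

Lemma innerZr H (a : R[i]) (x z : H) : '[z, a *: x] = Num.conj a * '[z, x].
Proof. by rewrite innerC innerZl rmorphM /= -!innerC. Qed.

Lemma ripC H (x y : H) : rip x y = rip y x.
Proof. by rewrite /rip innerC conjE. Qed.

Lemma ripDl H (x y z : H) : rip (x + y) z = rip x z + rip y z.
Proof. by rewrite /rip innerDl raddfD. Qed.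

Lemma ripDr H (x y z : H) : rip z (x + y) = rip z x + rip z y.
Proof. by rewrite /rip innerDr raddfD. Qed.

Lemma ripZl H (a : R) (x y : H) : rip (a%:C *: x) y = a * rip x y.
Proof. by rewrite /rip innerZl; case: '[x, y] => u v /=; rewrite mul0r subr0. Qed.

Lemma ripZr H (a : R) (x y : H) : rip x (a%:C *: y) = a * rip x y.
Proof. by rewrite ripC ripZl ripC. Qed.

Lemma ripNl H (x y : H) : rip (- x) y = - rip x y.
Proof.
have -> : - x = (-1)%:C *: x by rewrite rmorphN1 scaleN1r.
by rewrite ripZl mulN1r.
Qed.

Lemma ripNr H (x y : H) : rip x (- y) = - rip x y.
Proof. by rewrite ripC ripNl ripC. Qed.

Lemma rip0l H (y : H) : rip 0 y = 0.
Proof. by rewrite -(scale0r (0 : H)) -[0 in X in rip X]/(0%:C) ripZl mul0r. Qed.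

Lemma rip0r H (y : H) : rip y 0 = 0.
Proof. by rewrite ripC rip0l. Qed.

Definition ripE := (ripDl, ripDr, ripNl, ripNr, ripZl, ripZr, rip0l, rip0r).

Lemma ripJl H (x y : H) : rip ('i *: x) y = - rip x ('i *: y).
Proof.
rewrite /rip innerZl innerZr conjE; case: '[x, y] => u v /=.
ring.
Qed.

Lemma inner_Im H (x y : H) : complex.Im '[x, y] = rip x ('i *: y).
Proof.
rewrite /rip innerZr conjE; case: '[x, y] => u v /=.
ring.
Qed.

Lemma innerE H (x y : H) : '[x, y] = rip x y +i* rip x ('i *: y).
Proof. by rewrite -inner_Im /rip; case: '[x, y]. Qed.

Lemma scaleE H (a : R[i]) (x : H) :
  a *: x = (complex.Re a)%:C *: x + (complex.Im a)%:C *: ('i *: x).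
Proof. by rewrite {1}[a]complexE scalerDl mulrC scalerA. Qed.

Lemma rnormE H (x : H) : rnorm x ^+ 2 = rip x x.
Proof. by rewrite /rip inner_norm normE -rmorphXn. Qed.

Lemma rip_ge0 H (x : H) : 0 <= rip x x.
Proof. by rewrite -rnormE sqr_ge0. Qed.

Lemma rnorm_eq0 H (x : H) : rnorm x = 0 -> x = 0.
Proof. by move=> x0; apply/normr0_eq0; rewrite normE x0. Qed.

Lemma rip_eq0 H (x : H) : rip x x = 0 -> x = 0.
Proof.
by move=> /eqP; rewrite -rnormE sqrf_eq0 => /eqP /rnorm_eq0.
Qed.

Lemma rip_ext H (x y : H) : (forall z, rip z x = rip z y) -> x = y.
Proof.
move=> xy; apply/eqP; rewrite -subr_eq0; apply/eqP/rip_eq0.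
by rewrite ripDr ripNr xy subrr.
Qed.

Lemma rnorm_le H K (x : H) (y : K) : (rnorm x <= rnorm y) = (rip x x <= rip y y).
Proof. by rewrite -!rnormE ler_pXn2r// nnegrE rnorm_ge0. Qed.

Lemma le_rnorm H K (x : H) (y : K) : (`|x| <= `|y|) = (rip x x <= rip y y).
Proof. by rewrite !normE lecR rnorm_le. Qed.

Lemma eq_rnorm H K (x : H) (y : K) : `|x| = `|y| <-> rip x x = rip y y.
Proof.
rewrite -!rnormE !normE; split=> [[->//]|xy]; congr (_%:C).
by apply/eqP; rewrite -(@eqrXn2 _ 2)// ?rnorm_ge0// xy.
Qed.

Lemma rnorm0 H : rnorm (0 : H) = 0.
Proof. by rewrite /rnorm normr0. Qed.

Lemma rnormB H (x y : H) : rnorm (x - y) = rnorm (y - x).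
Proof. by rewrite /rnorm distrC. Qed.

Lemma rnormD H (x y : H) : rnorm (x + y) <= rnorm x + rnorm y.
Proof. by rewrite -lecR raddfD /= -!normE ler_normD. Qed.

Lemma rnormZ H (a : R) (x : H) : rnorm (a%:C *: x) = `|a| * rnorm x.
Proof.
apply: complexI; rewrite -normE normrZ rmorphM /= normE; congr (_ * _).
by rewrite normc_def /= expr0n addr0 sqrtr_sqr.
Qed.

Lemma rnormJ H (x : H) : rnorm ('i *: x) = rnorm x.
Proof.
apply: complexI; rewrite -!normE normrZ.
by rewrite normc_def /= expr0n expr1n add0r sqrtr1 mul1r.
Qed.

(** A nonnegative quadratic polynomial has a nonpositive discriminant. This is
    the common source of the Cauchy-Schwarz inequalities for the inner product
    and for the form of a positive operator. *)
Lemma discriminant_le (a b c : R) : 0 <= c ->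
  (forall t : R, 0 <= a + 2 * t * b + t ^+ 2 * c) -> b ^+ 2 <= a * c.
Proof.
move=> c0 h; have [c_eq0|c_neq0] := eqVneq c 0.
  suff -> : b = 0 by rewrite c_eq0 mulr0 expr0n.
  apply/eqP/negPn/negP => b0.
  have := h (- (a + 1) / (2 * b)); rewrite c_eq0 mulr0 addr0.
  have -> : a + 2 * (- (a + 1) / (2 * b)) * b = -1 by field.
  by rewrite ler0N1.
have {c_neq0 c0} c_gt0 : 0 < c by rewrite lt_neqAle eq_sym c_neq0.
have := h (- (b / c)).
have -> : a + 2 * - (b / c) * b + (- (b / c)) ^+ 2 * c = (a * c - b ^+ 2) / c.
  by field; rewrite gt_eqF.
by rewrite pmulr_lge0 ?invr_gt0// subr_ge0.
Qed.

Lemma rip_sqr_le H (x y : H) : rip x y ^+ 2 <= rip x x * rip y y.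
Proof.
apply: discriminant_le (rip_ge0 _) _ => t.
have := rip_ge0 (x + t%:C *: y).
by rewrite !ripE (ripC y x); congr (_ <= _); ring.
Qed.

Lemma rip_le H (x y : H) : `|rip x y| <= rnorm x * rnorm y.
Proof.
rewrite -(@ler_pXn2r _ 2)// ?nnegrE ?mulr_ge0 ?rnorm_ge0//.
by rewrite real_normK ?num_real// exprMn !rnormE rip_sqr_le.
Qed.

(** Adjoints are known only through inner products, so their norms are bounded
    by testing against all vectors. *)
Lemma rnorm_le_rip H (x : H) (c : R) : 0 <= c ->
  (forall y, rip x y <= c * rnorm y) -> rnorm x <= c.
Proof.
move=> c0 h; have [->|x0] := eqVneq x 0; first by rewrite rnorm0.
have xgt : 0 < rnorm x.
  by rewrite lt_neqAle rnorm_ge0 andbT eq_sym; apply: contra_neq x0 => /rnorm_eq0.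
by have := h x; rewrite -rnormE expr2 ler_pM2r.
Qed.

End RealParts.

(** * Convergence and boundedness *)

Section Topology.
Context {R : realType}.
Implicit Types H K L : hilbertType R.

(** The topology of a normed module over [R[i]] has radii in [R[i]]; these are
    its sequential notions with real radii. *)
Definition rcvg H (u : nat -> H) (l : H) : Prop :=
  forall e : R, 0 < e -> exists N, forall n, (N <= n)%N -> rnorm (u n - l) <= e.

Definition rcauchy H (u : nat -> H) : Prop :=
  forall e : R, 0 < e ->
    exists N, forall m n, (N <= m)%N -> (N <= n)%N -> rnorm (u m - u n) <= e.

Lemma natSinv_le (e : R) : 0 < e ->
  exists N, forall n, (N <= n)%N -> n.+1%:R^-1 <= e.
Proof.
move=> e0; have [N _ hN] := near_infty_natSinv_lt (PosNum e0).
by exists N => n Nn; apply/ltW/hN.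
Qed.

Lemma gt0_real (e : R[i]) : 0 < e -> exists2 r : R, 0 < r & e = r%:C.
Proof.
move=> e0; have er : e \is Num.real by rewrite gtr0_real.
by exists (complex.Re e); rewrite ?RRe_real// -ltcR RRe_real.
Qed.

Lemma rcvgP H (u : nat -> H) l : rcvg u l <-> u n @[n --> \oo] --> l.
Proof.
split=> [ul|ul].
  apply/cvgrPdist_le => e /gt0_real[r r0 ->].
  have [N hN] := ul _ r0; exists N => // n /= Nn.
  by rewrite distrC normE lecR hN.
move=> e e0; have /cvgrPdist_le /(_ e%:C) := ul.
rewrite ltcR => /(_ e0)[N _ hN]; exists N => n Nn.
by rewrite rnormB -lecR -normE; exact: hN.
Qed.

Lemma rcauchy_rcvg H (u : nat -> H) : rcauchy u -> exists l, rcvg u l.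
Proof.
move=> uc; have : cvg (u n @[n --> \oo]).
  apply: cauchy_cvg; apply/cauchy_ballP => e /gt0_real[r r0 ->].
  have [N hN] := uc (r / 2) (divr_gt0 r0 (ltr0Sn _ 1)).
  exists (u @` [set n | (N <= n)%N], u @` [set n | (N <= n)%N]).
    by split; exists N => // n /= Nn; exists n.
  move=> [_ _] /= [[m Nm <-] [n Nn <-]].
  rewrite -ball_normE /ball_ /= normE ltcR; apply: le_lt_trans (hN _ _ Nm Nn) _.
  by rewrite ltr_pdivrMr// ltr_pMr// ltr1n.
by case/cvg_ex => l ul; exists l; apply/rcvgP.
Qed.

Lemma closureP H (D : set H) x :
  closure D x <-> forall e : R, 0 < e -> exists2 y, D y & rnorm (x - y) <= e.
Proof.
split=> [Dx e e0|h].
  have [y [Dy]] : D `&` ball x e%:C !=set0.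
    by apply: Dx; apply: nbhsx_ballx; rewrite ltcR.
  rewrite -ball_normE /ball_ /= normE ltcR => /ltW xy; by exists y.
move=> B /nbhs_ballP[e /= /gt0_real[r r0 ->] eB].
have [y Dy xy] := h (r / 2) (divr_gt0 r0 (ltr0Sn _ 1)); exists y; split=> //.
apply: eB; rewrite -ball_normE /ball_ /= normE ltcR.
by apply: le_lt_trans xy _; rewrite ltr_pdivrMr// ltr_pMr// ltr1n.
Qed.

Definition rbounded H K (f : H -> K) : Prop :=
  exists2 c : R, 0 < c & forall x, rnorm (f x) <= c * rnorm x.

Lemma opL H K (f : 'B(H, K)) a x y : f (a *: x + y) = a *: f x + f y.
Proof. by rewrite linearP. Qed.

Lemma continuous_rbounded H K (f : H -> K) :
  linear f -> continuous f -> rbounded f.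
Proof.
move=> fl fc.
pose fL := GRing.isLinear.Build _ _ _ _ f fl.
pose F : {linear H -> K} := HB.pack f fL.
have /linear_boundedP : bounded_near F (nbhs 0) by apply/linear_bounded_continuous.
move=> /pinfty_ex_gt0[_ /gt0_real[r r0 ->]] h; exists r => // x.
by rewrite -lecR rmorphM /= -!normE h.
Qed.

Lemma rbounded_continuous H K (f : H -> K) :
  linear f -> rbounded f -> continuous f.
Proof.
move=> fl [c c0 fb].
pose fL := GRing.isLinear.Build _ _ _ _ f fl.
pose F : {linear H -> K} := HB.pack f fL.
apply: (@linear_bounded_continuous _ _ _ F).1; apply/linear_boundedP.
exists c%:C; split; first by rewrite gtr0_real// ltcR.
move=> e /ltW ce x; apply: le_trans (ler_wpM2r (normr_ge0 _) ce).
by rewrite !normE -rmorphM lecR.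
Qed.

Lemma op_bounded H K (f : 'B(H, K)) : rbounded f.
Proof. by apply: continuous_rbounded; [exact: opL|exact: cts_fun]. Qed.

Definition bop H K (f : H -> K) (fl : linear f) (fb : rbounded f) : 'B(H, K) :=
  HB.pack f (GRing.isLinear.Build _ _ _ _ f fl)
    (isContinuous.Build _ _ f (rbounded_continuous fl fb)).

End Topology.

(** * Hilbert spaces from inner products *)

(** Completeness is asked for sequences only. A Cauchy filter reduces to the
    sequence obtained by picking, for each [n], a point in a member of the filter
    of diameter at most [1 / (n + 1)]. *)
HB.factory Record InnerProduct_isHilbert (R : realType) H
    & GRing.Lmodule R[i] H := {
  ip : H -> H -> R[i];
  ip_linear : forall a x y z, ip (a *: x + y) z = a * ip x z + ip y z;
  ip_conj : forall x y, ip x y = Num.conj (ip y x);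
  ip_gt0 : forall x, x != 0 -> 0 < ip x x;
  ip_complete : forall u : nat -> H,
    (forall e : R, 0 < e -> exists N, forall m n, (N <= m)%N -> (N <= n)%N ->
      complex.Re (ip (u m - u n) (u m - u n)) <= e ^+ 2) ->
    exists l, forall e : R, 0 < e -> exists N, forall n, (N <= n)%N ->
      complex.Re (ip (u n - l) (u n - l)) <= e ^+ 2
}.

HB.builders Context R H & InnerProduct_isHilbert R H.

Let q x y : R := complex.Re (ip x y).
Let nrm x : R := Num.sqrt (q x x).

Let qC x y : q x y = q y x.
Proof. by rewrite /q ip_conj conjE. Qed.

Let ip0 z : ip 0 z = 0.
Proof. by have := ip_linear (-1) 0 0 z; rewrite scaler0 addr0 mulN1r addNr. Qed.

Let qD x y z : q (x + y) z = q x z + q y z.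
Proof. by rewrite /q -[x]scale1r ip_linear mul1r raddfD scale1r. Qed.

Let ipZ a x z : ip (a *: x) z = a * ip x z.
Proof. by rewrite -[a *: x]addr0 ip_linear ip0 addr0. Qed.

Let qZ (a : R) x z : q (a%:C *: x) z = a * q x z.
Proof. by rewrite /q ipZ; case: (ip x z) => u v /=; ring. Qed.

Let q_ge0 x : 0 <= q x x.
Proof.
have [->|x0] := eqVneq x 0; first by rewrite /q ip0.
by rewrite /q ltW//; have := ip_gt0 x0; rewrite ltcE => /andP[].
Qed.

Let q_CS x y : q x y ^+ 2 <= q x x * q y y.
Proof.
apply: discriminant_le (q_ge0 _) _ => t.
have := q_ge0 (x + t%:C *: y).
rewrite qD qZ !(qC _ (x + _)) !qD !qZ (qC y x).
by congr (_ <= _); ring.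
Qed.

Let ipE x : ip x x = (q x x)%:C.
Proof.
have [->|x0] := eqVneq x 0; first by rewrite /q ip0.
by rewrite /q RRe_real// gtr0_real// ip_gt0.
Qed.

Let nrmE x : nrm x ^+ 2 = q x x.
Proof. by rewrite sqr_sqrtr. Qed.

Let nrm_ge0 x : 0 <= nrm x.
Proof. exact: sqrtr_ge0. Qed.

Let nrmD x y : (nrm (x + y))%:C <= (nrm x)%:C + (nrm y)%:C :> R[i].
Proof.
rewrite -rmorphD lecR -(@ler_pXn2r _ 2)// ?nnegrE ?addr_ge0//.
rewrite sqrrD !nrmE !(qD, qC _ (x + _)) (qC y x).
suff : q x y <= nrm x * nrm y by lra.
apply: le_trans (ler_norm _) _.
rewrite -(@ler_pXn2r _ 2)// ?nnegrE ?mulr_ge0//.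
by rewrite real_normK ?num_real// exprMn !nrmE q_CS.
Qed.

Let nrmZ (a : R[i]) x : (nrm (a *: x))%:C = `|a| * (nrm x)%:C :> R[i].
Proof.
rewrite normc_def -rmorphM; congr (_%:C).
rewrite -sqrtrM ?addr_ge0 ?sqr_ge0//; congr Num.sqrt.
rewrite /q ipZ ip_conj ipZ rmorphM /= !conjE ipE; case: a => u v /=.
by ring.
Qed.

Let nrm_eq0 x : (nrm x)%:C = 0 :> R[i] -> x = 0.
Proof.
move=> /complexI h; apply/eqP/negPn/negP => /ip_gt0.
by rewrite ipE -nrmE h expr0n ltxx.
Qed.

HB.instance Definition _ := Lmodule_isNormed.Build R[i] H nrmD nrmZ nrm_eq0.

Let nE (x : H) : `|x| = (nrm x)%:C. Proof. by []. Qed.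

Let complete (F : set_system H) : ProperFilter F -> cauchy F -> cvg F.
Proof.
move=> FF /cauchy_ballP Fc.
have small n : exists uA : H * set H, [/\ F uA.2, uA.2 uA.1 &
    forall x y, uA.2 x -> uA.2 y -> nrm (x - y) <= n.+1%:R^-1].
  have e0 : 0 < (n.+1%:R^-1)%:C :> R[i] by rewrite ltcR invr_gt0 ltr0n.
  have [[P Q] [/= FP FQ] PQ] := Fc _ e0.
  have FPQ : F (P `&` Q) by apply: filterI.
  have [u [Pu Qu]] := filter_ex FPQ.
  exists (u, P `&` Q); split=> //= x y [Px _] [_ Qy].
  by have := PQ (x, y) (conj Px Qy); rewrite -ball_normE /ball_ /= nE ltcR => /ltW.
have [uA uAP] := choice small.
have near2 m n : nrm ((uA m).1 - (uA n).1) <= m.+1%:R^-1 + n.+1%:R^-1.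
  have [Fm um Am] := uAP m; have [Fn un An] := uAP n.
  have [w [wm wn]] := filter_ex (filterI Fm Fn).
  rewrite -lecR -(subrKA w); apply: le_trans (nrmD _ _) _.
  by rewrite -rmorphD lecR lerD ?Am ?An.
have [|l ul] := @ip_complete (fun n => (uA n).1).
  move=> e e0; have [N dN] := natSinv_le (divr_gt0 e0 (ltr0Sn _ 1)).
  exists N => m n Nm Nn; rewrite -/(q _ _) -nrmE ler_pXn2r// ?nnegrE ?(ltW e0)//.
  by apply: le_trans (near2 _ _) _; rewrite [leRHS]splitr lerD ?dN.
apply/cvg_ex; exists l; apply/cvgrPdist_le => _ /gt0_real[e e0 ->].
have e2 : 0 < e / 2 by rewrite divr_gt0.
have [N1 hN1] := ul _ e2; have [N2 hN2] := natSinv_le e2.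
pose n := maxn N1 N2; have [Fn un An] := uAP n.
have {}hN1 : nrm ((uA n).1 - l) <= e / 2.
  rewrite -(@ler_pXn2r _ 2)// ?nnegrE ?(ltW e2)// nrmE.
  exact/hN1/leq_maxl.
have {}hN2 := hN2 n (leq_maxr _ _).
apply: filterS Fn => x Ax /=; rewrite distrC nE.
rewrite -(subrKA (uA n).1); apply: le_trans (nrmD _ _) _.
rewrite -rmorphD lecR.
by rewrite [leRHS]splitr lerD// (le_trans (An _ _ Ax un)).
Qed.

HB.instance Definition _ := Uniform_isComplete.Build H complete.

Let ip_bilinear : bilinear_for
  (GRing.Scale.Law.clone _ _ *%R _)
  (GRing.Scale.Law.clone _ _ (@Num.conj R[i] \; *%R) _) ip.
Proof.
split=> [z a x y|z a x y] /=; first exact: ip_linear.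
by rewrite ip_conj ip_linear rmorphD rmorphM /= -!ip_conj.
Qed.

HB.instance Definition _ := bilinear_isBilinear.Build R[i] H H R[i]
  _ _ ip ip_bilinear.

Let ip_herm x y : ip x y = (-1) ^+ false * Num.conj (ip y x).
Proof. by rewrite expr0 mul1r ip_conj. Qed.

HB.instance Definition _ := isHermitianSesquilinear.Build R[i] H
  false Num.conj ip ip_herm.

HB.instance Definition _ := isDotProduct.Build R[i] H ip ip_gt0.

Let ip_norm (x : H) : ip x x = `|x| ^+ 2.
Proof. by rewrite nE ipE -nrmE rmorphXn. Qed.

HB.instance Definition _ := CompleteNormedModule_isHilbert.Build R H ip_norm.

HB.end.

Section Limits.
Context {R : realType}.
Implicit Types H K L : hilbertType R.

Lemma rcvg_le H (u : nat -> H) l x (c : R) :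
  rcvg u l -> (\forall n \near \oo, rnorm (u n - x) <= c) -> rnorm (l - x) <= c.
Proof.
move=> ul [M _ hM]; rewrite leNgt; apply/negP => cx.
have e0 : 0 < (rnorm (l - x) - c) / 2 by rewrite divr_gt0 ?subr_gt0.
have [N hN] := ul _ e0; pose n := maxn M N.
have := hM n (leq_maxl _ _); have := hN n (leq_maxr _ _) => /=.
have : rnorm (l - x) <= rnorm (u n - l) + rnorm (u n - x).
  by rewrite (rnormB (u n) l) -[l - x](subrKA (u n)) rnormD.
by lra.
Qed.

Lemma closed_rcvg H (U : set H) (u : nat -> H) l :
  closed U -> (forall n, U (u n)) -> rcvg u l -> U l.
Proof.
move=> Uc Uu ul; apply: Uc; apply/closureP => e e0.
by have [N hN] := ul _ e0; exists (u N) => //; rewrite rnormB hN.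
Qed.

Lemma rnorm_cvg H (u : nat -> H) l :
  rcvg u l -> rnorm (u n) @[n --> \oo] --> rnorm l.
Proof.
move=> ul; apply/cvgrPdist_le => e e0; have [N hN] := ul _ e0.
exists N => // n /= Nn; apply: le_trans (hN n Nn); rewrite ler_norml.
have := rnormD (u n) (l - u n); have := rnormD l (u n - l).
by rewrite !subrKC (rnormB l); lra.
Qed.

End Limits.

(** * Closed subspaces *)

Section Subspace.
Context {R : realType}.

(** The truth value of the membership makes this a subtype of [H], so that the
    module structure of [H] restricts to it. *)
Record hsubspace (H : hilbertType R) (U : set H) (hU : closed_subspace U) :=
  HSubspace { sub_val : H; sub_valP : `[< U sub_val >] }.

Variables (H : hilbertType R) (U : set H) (hU : closed_subspace U).

HB.instance Definition _ := [isSub for @sub_val H U hU].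
HB.instance Definition _ := [Choice of hsubspace hU by <:].

Let subspace_closed : GRing.subsemimod_closed (fun x : H => `[< U x >]).
Proof.
have [U0 UD _] := hU; split; first split.
- exact/asboolP.
- move=> x y /asboolP Ux /asboolP Uy; apply/asboolP.
  by rewrite -[x]scale1r; exact: UD.
- move=> a x /asboolP Ux; apply/asboolP.
  by rewrite -[a *: x]addr0; exact: UD.
Qed.

HB.instance Definition _ :=
  GRing.SubChoice_isSubLmodule.Build R[i] H _ (hsubspace hU) subspace_closed.

Let sip (x y : hsubspace hU) := '[val x, val y].

Let sip_complete (u : nat -> hsubspace hU) :
    (forall e : R, 0 < e -> exists N, forall m n, (N <= m)%N -> (N <= n)%N ->
      complex.Re (sip (u m - u n) (u m - u n)) <= e ^+ 2) ->
    exists l, forall e : R, 0 < e -> exists N, forall n, (N <= n)%N ->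
      complex.Re (sip (u n - l) (u n - l)) <= e ^+ 2.
Proof.
have sE x y e : 0 < e ->
    (complex.Re (sip (x - y) (x - y)) <= e ^+ 2) = (rnorm (val x - val y) <= e).
  move=> e0; rewrite /sip -/(rip _ _) -rnormE raddfB.
  by rewrite ler_pXn2r// nnegrE ?rnorm_ge0// ltW.
move=> uc; have [|l ul] := @rcauchy_rcvg _ H (fun n => val (u n)).
  move=> e e0; have [N hN] := uc e e0; exists N => m n Nm Nn.
  by rewrite -sE// hN.
have Ul : `[< U l >].
  apply/asboolP; apply: closed_rcvg ul; first by case: hU.
  by move=> n; apply/asboolP; exact: sub_valP.
exists (HSubspace hU Ul) => e e0; have [N hN] := ul e e0.
by exists N => n Nn; rewrite sE// hN.
Qed.

Let sip_linear a (x y z : hsubspace hU) :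
  sip (a *: x + y) z = a * sip x z + sip y z.
Proof. by rewrite /sip linearP innerDl innerZl. Qed.

Let sip_conj x y : sip x y = Num.conj (sip y x).
Proof. exact: innerC. Qed.

Let sip_gt0 (x : hsubspace hU) : x != 0 -> 0 < sip x x.
Proof.
move=> x0; apply: neq0_dnorm_gt0; apply: contra_neq x0 => x0.
by apply: val_inj; rewrite x0 raddf0.
Qed.

HB.instance Definition _ := InnerProduct_isHilbert.Build R (hsubspace hU)
  sip_linear sip_conj sip_gt0 sip_complete.

Lemma sub_val_linear : linear (@sub_val H U hU).
Proof. by move=> a x y; exact: (linearP (val : hsubspace hU -> H)). Qed.

Lemma rip_sub (x y : hsubspace hU) : rip x y = rip (sub_val x) (sub_val y).
Proof. by []. Qed.

End Subspace.

(** * Square-summable sequences *)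

Section SquareSummable.
Context {R : realType}.
Variable H : hilbertType R.
Implicit Types f g h : nat -> H.

Definition psum f g (N : nat) : R := \sum_(k < N) rip (f k) (g k).

Definition l2 f : Prop := exists M, forall N, psum f f N <= M.

Lemma psumC f g : psum f g = psum g f.
Proof. by apply/funext => N; apply: eq_bigr => k _; exact: ripC. Qed.

Lemma psumDl f g h N : psum (f + g) h N = psum f h N + psum g h N.
Proof.
by rewrite /psum -big_split /=; apply: eq_bigr => k _; rewrite ripDl.
Qed.

Lemma psumZl (a : R) f h N : psum (a%:C *: f) h N = a * psum f h N.
Proof. by rewrite /psum mulr_sumr; apply: eq_bigr => k _; rewrite ripZl. Qed.

Lemma psumJl f h N : psum ('i *: f) h N = - psum f ('i *: h) N.
Proof. by rewrite /psum -sumrN; apply: eq_bigr => k _; rewrite ripJl. Qed.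

Lemma psum_nd f : nondecreasing_seq (psum f f).
Proof.
apply/nondecreasing_seqP => N.
by rewrite /psum big_ord_recr lerDl rip_ge0.
Qed.

Lemma l20 : l2 0.
Proof. by exists 0 => N; rewrite /psum big1// => k _; rewrite rip0l. Qed.

Lemma l2D f g : l2 f -> l2 g -> l2 (f + g).
Proof.
move=> [M fM] [M' gM]; exists (2 * (M + M')) => N.
apply: le_trans (ler_wpM2l _ (lerD (fM N) (gM N))) => //.
rewrite -big_split mulr_sumr; apply: ler_sum => k _ /=.
have := rip_ge0 (f k - g k); rewrite !ripE (ripC (g k)); lra.
Qed.

Lemma l2Zr (a : R) f : l2 f -> l2 (a%:C *: f).
Proof.
move=> [M fM]; exists (a ^+ 2 * M) => N.
apply: le_trans (ler_wpM2l (sqr_ge0 a) (fM N)).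
by rewrite mulr_sumr; apply: ler_sum => k _; rewrite !ripE mulrA.
Qed.

Lemma l2J f : l2 f -> l2 ('i *: f).
Proof.
move=> [M fM]; exists M => N; apply: le_trans (fM N).
by apply: ler_sum => k _; rewrite -!rnormE rnormJ.
Qed.

Lemma l2Z a f : l2 f -> l2 (a *: f).
Proof.
move=> lf; have -> : a *: f =
    (complex.Re a)%:C *: f + (complex.Im a)%:C *: ('i *: f).
  by apply/funext => k; exact: scaleE.
by apply: l2D; apply: l2Zr => //; exact: l2J.
Qed.

(** By polarization it is enough to treat [f = g], where the partial sums are
    monotone. *)
Lemma psum_cvg f g : l2 f -> l2 g -> cvgn (psum f g).
Proof.
have cvg1 h : l2 h -> cvgn (psum h h).
  move=> [M hM]; apply: nondecreasing_is_cvgn; first exact: psum_nd.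
  by exists M => _ [N _ <-].
move=> lf lg; have -> : psum f g = (fun N =>
    4^-1 * (psum (f + g) (f + g) N
            - psum (f + (-1)%:C *: g) (f + (-1)%:C *: g) N)).
  apply/funext => N.
  rewrite !(psumDl, psumC _ (_ + _)) !psumZl !(psumC _ (_ *: _)) !psumZl (psumC g f).
  by field.
apply: is_cvgMr; apply: is_cvgB; apply: cvg1; apply: l2D => //.
exact: l2Zr.
Qed.

End SquareSummable.

Section Ell2.
Context {R : realType}.

Record ell2 (H : hilbertType R) :=
  Ell2 { ell_val :> nat -> H; ell_valP : `[< l2 ell_val >] }.

Variable H : hilbertType R.
Implicit Types f g h : ell2 H.

HB.instance Definition _ := [isSub for @ell_val H].
HB.instance Definition _ := [Choice of ell2 H by <:].

Let ell2_closed : GRing.subsemimod_closed (fun f : nat -> H => `[< l2 f >]).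
Proof.
split; first split.
- exact/asboolP/l20.
- by move=> f g /asboolP lf /asboolP lg; apply/asboolP/l2D.
- by move=> a f /asboolP lf; apply/asboolP/l2Z.
Qed.

HB.instance Definition _ :=
  GRing.SubChoice_isSubLmodule.Build R[i] (nat -> H) _ (ell2 H) ell2_closed.

Lemma ell_l2 f : l2 f. Proof. by apply/asboolP; exact: ell_valP. Qed.

Lemma ellP f g : (forall k, f k = g k) -> f = g.
Proof. by move=> fg; apply: val_inj; apply/funext. Qed.

Let lrip (f g : nat -> H) : R := limn (psum f g).

Let lripC f g : lrip f g = lrip g f.
Proof. by rewrite /lrip psumC. Qed.

Let lripDl (f g h : ell2 H) : lrip (f + g) h = lrip f h + lrip g h.
Proof.
rewrite /lrip -limD; [|exact/psum_cvg/ell_l2/ell_l2..].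
by congr (limn _); apply/funext => N; exact: psumDl.
Qed.

Let lripZl (a : R) (f h : ell2 H) : lrip (a%:C *: f) h = a * lrip f h.
Proof.
apply: cvg_lim => //; rewrite (_ : psum _ _ = fun N => a * psum f h N).
  by apply: cvgM; [exact: cvg_cst|exact/psum_cvg/ell_l2/ell_l2].
by apply/funext => N; exact: psumZl.
Qed.

Let lripJl (f h : ell2 H) : lrip ('i *: f) h = - lrip f ('i *: h).
Proof.
rewrite /lrip -limN; last exact/psum_cvg/ell_l2/ell_l2.
by congr (limn _); apply/funext => N; exact: psumJl.
Qed.

Let lrip_ge (f : ell2 H) N : psum f f N <= lrip f f.
Proof.
apply: nondecreasing_cvgn_le; first exact: psum_nd.
exact/psum_cvg/ell_l2/ell_l2.
Qed.

Let lrip_le (f : ell2 H) c : (forall N, psum f f N <= c) -> lrip f f <= c.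
Proof.
move=> fc; apply: limr_le; first exact/psum_cvg/ell_l2/ell_l2.
by near=> N; exact: fc.
Unshelve. all: by end_near. Qed.

Let scaleE' (a : R[i]) (x : ell2 H) :
  a *: x = (complex.Re a)%:C *: x + (complex.Im a)%:C *: ('i *: x).
Proof. by rewrite {1}[a]complexE scalerDl mulrC scalerA. Qed.

Let eip (f g : ell2 H) : R[i] := lrip f g +i* lrip f ('i *: g).

Let eip_linear a (f g h : ell2 H) : eip (a *: f + g) h = a * eip f h + eip g h.
Proof.
rewrite /eip !lripDl [a *: f]scaleE' !lripDl !lripZl !lripJl.
have -> : lrip f ('i *: ('i *: h)) = - lrip f h.
  by rewrite scalerA -expr2 sqr_i scaleN1r -scaleN1r -(rmorphN1 (real_complex R))
    lripC lripZl lripC mulN1r.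
by case: a => u v; apply/eqP; rewrite eq_complex /=; apply/andP; split; apply/eqP; ring.
Qed.

Let eip_conj (f g : ell2 H) : eip f g = Num.conj (eip g f).
Proof. by rewrite conjE /eip /= lripC; congr (_ +i* _); rewrite -lripJl lripC. Qed.

Let eip_gt0 (f : ell2 H) : f != 0 -> 0 < eip f f.
Proof.
move=> f0; rewrite ltcE /=.
have := lripJl f f; rewrite lripC => h.
have -> /= : lrip f ('i *: f) = 0 by move: h; lra.
rewrite eqxx /=.
have [k fk] : exists k, f k != 0.
  apply: contrapT => hf; move/eqP: f0; apply; apply: ellP => k.
  by apply/eqP/negPn/negP => fk; apply: hf; exists k.
apply: lt_le_trans (lrip_ge f k.+1).
rewrite /psum big_ord_recr /= ltr_wpDl//.
  by apply: sumr_ge0 => i _; exact: rip_ge0.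
by rewrite lt_neqAle rip_ge0 andbT eq_sym; apply: contra_neq fk => /rip_eq0.
Qed.

(** Coordinatewise limits, as usual: each partial sum inherits the Cauchy bound
    when one index tends to infinity. *)
Let eip_complete (u : nat -> ell2 H) :
    (forall e : R, 0 < e -> exists N, forall m n, (N <= m)%N -> (N <= n)%N ->
      complex.Re (eip (u m - u n) (u m - u n)) <= e ^+ 2) ->
    exists l, forall e : R, 0 < e -> exists N, forall n, (N <= n)%N ->
      complex.Re (eip (u n - l) (u n - l)) <= e ^+ 2.
Proof.
rewrite /eip /= => uc.
have coord k : exists l, rcvg (fun n => u n k) l.
  apply: rcauchy_rcvg => e e0; have [N hN] := uc e e0.
  exists N => m n Nm Nn.
  rewrite -(@ler_pXn2r _ 2)// ?nnegrE ?rnorm_ge0 ?(ltW e0)// rnormE.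
  apply: le_trans (hN m n Nm Nn); apply: le_trans (lrip_ge (u m - u n) k.+1).
  rewrite /psum big_ord_recr /= lerDr; apply: sumr_ge0 => i _; exact: rip_ge0.
have [l hl] := choice coord.
have bnd e : 0 < e -> exists N, forall n, (N <= n)%N -> forall M,
    psum (ell_val (u n) - l) (ell_val (u n) - l) M <= e ^+ 2.
  move=> e0; have [N hN] := uc e e0; exists N => n Nn M.
  have cv : psum (u n - u m) (u n - u m) M @[m --> \oo] -->
      psum (ell_val (u n) - l) (ell_val (u n) - l) M.
    apply: (cvg_big (op := +%R)) => [|k _]; first exact: add_continuous.
    rewrite (_ : (fun _ => _) =
      (fun m => rnorm (u n k - u m k) * rnorm (u n k - u m k))); last first.
      by apply/funext => m; rewrite -expr2 rnormE.
    rewrite -rnormE expr2.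
    have h : rnorm (u n k - u m k) @[m --> \oo] --> rnorm (u n k - l k).
      apply: rnorm_cvg => d d0; have [N' hN'] := hl k d d0; exists N' => m N'm.
      by rewrite opprB addrC subrKA rnormB hN'.
    exact: cvgM.
  rewrite -(cvg_lim _ cv)//; apply: limr_le; first by apply/cvg_ex; eexists; exact: cv.
  exists N => // m /= Nm; apply: le_trans (hN n m Nn Nm).
  exact: (lrip_ge (u n - u m)).
have ll : `[< l2 l >].
  apply/asboolP; have [N hN] := bnd 1 ltr01.
  have -> : l = ell_val (u N) + (-1)%:C *: (ell_val (u N) - l).
    apply/funext => k; rewrite rmorphN1 scaleN1r.
    by rewrite -[RHS]/(u N k + - (u N k - l k)) opprB addrC subrK.
  apply: l2D; first exact: ell_l2.
  by apply: l2Zr; exists (1 ^+ 2) => M; exact: hN.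
exists (Ell2 ll) => e e0; have [N hN] := bnd e e0; exists N => n Nn.
by apply: (@lrip_le (u n - Ell2 ll)) => M; exact: hN.
Qed.

HB.instance Definition _ := InnerProduct_isHilbert.Build R (ell2 H)
  eip_linear eip_conj eip_gt0 eip_complete.

Lemma rip_ell f g : rip f g = limn (psum f g).
Proof. by []. Qed.

Lemma psum_le_rip f N : psum f f N <= rip f f.
Proof. exact: lrip_ge. Qed.

End Ell2.

(** * Riesz representation *)

Section Riesz.
Context {R : realType}.
Implicit Types H K L : hilbertType R.

Definition real_subspace H (D : set H) : Prop :=
  D 0 /\ forall (a : R) x y, D x -> D y -> D (a%:C *: x + y).

Lemma rip_sub_sqr H (x y : H) :
  rip (x - y) (x - y) = rip x x - 2 * rip x y + rip y y.
Proof. by rewrite !ripE (ripC y x); ring. Qed.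

Lemma rip_add_sqr H (x y : H) :
  rip (x + y) (x + y) = rip x x + 2 * rip x y + rip y y.
Proof. by rewrite !ripE (ripC y x); ring. Qed.

Lemma closure_rip_le H (D : set H) (z w : H) (c : R) : 0 <= c ->
  (forall x, D x -> rip x w <= c * rnorm x) -> closure D z ->
  rip z w <= c * rnorm z.
Proof.
move=> c0 h /closureP Dz; apply/ler_addgt0Pr => e e0.
have d0 : 0 < e / (rnorm w + c + 1).
  by rewrite divr_gt0// ltr_wpDl// addr_ge0// rnorm_ge0.
have [x Dx zx] := Dz _ d0.
have -> : rip z w = rip (z - x) w + rip x w by rewrite -ripDl subrK.
have h1 := le_trans (ler_norm _) (rip_le (z - x) w).
have h2 := h x Dx.
have h3 : rnorm x <= rnorm z + rnorm (z - x).
  by rewrite (rnormB z); have := rnormD z (x - z); rewrite subrKC.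
have h4 : rnorm (z - x) * (rnorm w + c) <= e.
  rewrite -[leRHS](@divfK _ (rnorm w + c + 1)).
    apply: ler_pM; rewrite ?rnorm_ge0 ?addr_ge0 ?rnorm_ge0//.
    by rewrite lerDl.
  by rewrite gt_eqF// ltr_wpDl// addr_ge0// rnorm_ge0.
have := ler_wpM2l c0 h3; move: h1 h2 h4; lra.
Qed.

Lemma closure_rip_eq H (D : set H) (z u v : H) :
  (forall x, D x -> rip x u = rip x v) -> closure D z -> rip z u = rip z v.
Proof.
move=> h Dz; suff h' u' v' : (forall x, D x -> rip x u' = rip x v') ->
    rip z u' <= rip z v'.
  by apply/eqP; rewrite eq_le !h'// => x Dx; rewrite h.
move=> h''; rewrite -subr_le0 -ripNr -ripDr.
have := @closure_rip_le _ D z (u' - v') 0 (lexx _); rewrite mul0r; apply=> // x Dx.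
by rewrite ripDr ripNr h''// subrr mul0r.
Qed.

Section minimization.
Variables (H : hilbertType R) (D : set H) (phi : H -> R) (c : R).
Hypothesis hD : real_subspace D.
Hypothesis phi_lin : forall (a : R) x y, D x -> D y ->
  phi (a%:C *: x + y) = a * phi x + phi y.
Hypothesis phi_le : forall x, D x -> phi x <= c * rnorm x.

Let J (x : H) := rip x x - 2 * phi x.

Let J_ge x : D x -> - c ^+ 2 <= J x.
Proof.
move=> /phi_le hx; rewrite /J -rnormE.
have := sqr_ge0 (rnorm x - c); rewrite sqrrB; lra.
Qed.

Let d := inf [set J x | x in D].

Let J_has_inf : has_inf [set J x | x in D].
Proof.
split; first by exists (J 0); exists 0 => //; case: hD.
by exists (- c ^+ 2) => _ [x Dx <-]; exact: J_ge.
Qed.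

Let d_le x : D x -> d <= J x.
Proof. by move=> Dx; apply: ge_inf; [case: J_has_inf|exists x]. Qed.

Let near_min n : exists x, D x /\ J x <= d + n.+1%:R^-1.
Proof.
have e0 : 0 < n.+1%:R^-1 :> R by rewrite invr_gt0.
by have [_ [x Dx <-] /ltW hx] := inf_adherent e0 J_has_inf; exists x.
Qed.

(** The parallelogram identity makes minimizing sequences Cauchy. *)
Let J_parallelogram x y : D x -> D y ->
  rip (x - y) (x - y) <= 2 * J x + 2 * J y - 4 * d.
Proof.
move=> Dx Dy; have D0 := hD.1.
have Dz : D (2^-1%:C *: (1%:C *: x + y)).
  by rewrite -[_ *: _]addr0; apply: hD.2 => //; exact: hD.2.
have := d_le Dz; rewrite /J -[2^-1%:C *: _]addr0 !phi_lin//; last exact: hD.2.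
have -> : phi 0 = 0.
  by have := phi_lin 1 D0 D0; rewrite scaler0 addr0; lra.
rewrite addr0 !ripE (ripC y x); lra.
Qed.

(** The representing vector is the limit of a sequence minimizing
    [J x = |x|^2 - 2 phi x], since the first variation of [J] vanishes there. With
    real linearity on an arbitrary real subspace as the setting, the same lemma
    yields adjoints of operators, [adj_on], contractive factorizations and
    asymptotic limits. *)
Lemma riesz : exists z, closure D z /\ forall x, D x -> rip x z = phi x.
Proof.
have [u hu] := choice near_min.
have [|z uz] := @rcauchy_rcvg _ _ u.
  move=> e e0; have e2 : 0 < e ^+ 2 / 4 by rewrite divr_gt0// exprn_gt0.
  have [N hN] := natSinv_le e2; exists N => m n Nm Nn.
  have [Dm um] := hu m; have [Dn un] := hu n.
  rewrite -(@ler_pXn2r _ 2)// ?nnegrE ?rnorm_ge0 ?(ltW e0)// rnormE.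
  have := J_parallelogram Dm Dn.
  have := hN _ Nm; have := hN _ Nn; move: um un; set a := _^-1; set b := _^-1; lra.
exists z; split.
  apply/closureP => e e0; have [N hN] := uz e e0; exists (u N).
    by case: (hu N).
  by rewrite rnormB hN.
move=> x Dx; apply/eqP; rewrite -subr_eq0 -normr_le0; apply/ler_addgt0Pr => e e0.
rewrite add0r.
have approx n : (rip (u n) x - phi x) ^+ 2 <= n.+1%:R^-1 * rip x x.
  apply: discriminant_le (rip_ge0 _) _ => t.
  have [Dn un] := hu n.
  (* First variation of [J] at the almost minimal [u n], in the direction [x]. *)
  have := d_le (hD.2 t _ _ Dx Dn); rewrite /J phi_lin// !ripE (ripC x (u n)).
  move: un; rewrite /J; set a := _^-1; lra.
have a0 : 0 < e / (2 * (rnorm x + 1)).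
  by rewrite divr_gt0// mulr_gt0// ltr_wpDl// rnorm_ge0.
have [N hN] := uz _ a0.
have b0 : 0 < (e / (2 * (rnorm x + 1))) ^+ 2 by rewrite exprn_gt0.
have [M hM] := natSinv_le b0.
pose n := maxn N M.
set del := e / _ in a0 hN b0 hM.
have dele : del * rnorm x <= e / 2.
  have n1 : 0 < rnorm x + 1 by rewrite ltr_wpDl// rnorm_ge0.
  have -> : del * rnorm x = e / 2 * (rnorm x / (rnorm x + 1)).
    by rewrite /del; field; rewrite gt_eqF.
  apply: ler_piMr; first by rewrite divr_ge0// ltW.
  by rewrite ler_pdivrMr// mul1r lerDl.
clearbody del.
have h1 : `|rip (u n) x - phi x| <= e / 2.
  apply: (le_trans _ dele); rewrite -(@ler_pXn2r _ 2) ?nnegrE ?mulr_ge0 ?rnorm_ge0 ?(ltW a0)//.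
  rewrite real_normK ?num_real// exprMn rnormE; apply: le_trans (approx n) _.
  by rewrite ler_wpM2r ?rip_ge0// hM// leq_maxr.
have h2 : `|rip (z - u n) x| <= e / 2.
  apply: le_trans (rip_le _ _) _; apply: (le_trans _ dele).
  by rewrite ler_wpM2r ?rnorm_ge0// rnormB hN// leq_maxl.
rewrite [leRHS]splitr (ripC x z).
have -> : rip z x - phi x = rip (z - u n) x + (rip (u n) x - phi x).
  by rewrite ripDl ripNl; ring.
by apply: le_trans (ler_normD _ _) _; rewrite lerD.
Qed.

End minimization.

End Riesz.

(** * Adjoints and contractive factorization *)

Section Adjoint.
Context {R : realType}.
Implicit Types H K L : hilbertType R.

Lemma rip_conjZ H (a : R[i]) (x y : H) : rip x (a *: y) = rip (Num.conj a *: x) y.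
Proof. by rewrite /rip innerZr innerZl. Qed.

Lemma closed_subspace_real H (D : set H) : closed_subspace D -> real_subspace D.
Proof. by move=> [D0 DD _]; split=> // a x y; exact: DD. Qed.

Lemma closed_subspaceT H : closed_subspace [set: H].
Proof. by split=> //; exact: closedT. Qed.

Lemma closed_subspace_closure H (D : set H) : D 0 ->
  (forall (a : R[i]) x y, D x -> D y -> D (a *: x + y)) ->
  closed_subspace (closure D).
Proof.
move=> D0 DD; split; first exact: subset_closure.
  move=> a x y /closureP Dx /closureP Dy; apply/closureP => e e0.
  have n0 : 0 < complex.Re `|a| + 1.
    by rewrite ltr_wpDl// -ler0c RRe_real// ger0_real.
  have e1 : 0 < e / 2 / (complex.Re `|a| + 1) by rewrite !divr_gt0.
  have e2 : 0 < e / 2 by rewrite divr_gt0.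
  have [x' Dx' xx'] := Dx _ e1; have [y' Dy' yy'] := Dy _ e2.
  exists (a *: x' + y'); first exact: DD.
  rewrite opprD addrACA -scalerBr [leRHS]splitr.
  apply: le_trans (rnormD _ _) _; apply: lerD yy'.
  have -> : rnorm (a *: (x - x')) = complex.Re `|a| * rnorm (x - x').
    by apply: complexI; rewrite -normE normrZ rmorphM normE; congr (_ * _).
  rewrite ler_pdivlMr// in xx'; apply: (le_trans _ xx').
  by rewrite mulrC ler_wpM2l ?rnorm_ge0// lerDl.
exact: closed_closure.
Qed.

(** Defining property of [adj_on] for a map that is linear and bounded on [D];
    it is complex linearity on [D] that upgrades the real parts of the inner
    products to the inner products themselves. *)
Lemma adj_onP H K (D : set H) (J : H -> K) (c : R) (y : K) :
  closed_subspace D -> 0 <= c ->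
  (forall (a : R[i]) x x', D x -> D x' -> J (a *: x + x') = a *: J x + J x') ->
  (forall x, D x -> rnorm (J x) <= c * rnorm x) ->
  D (adj_on D J y) /\ forall x, D x -> rip (J x) y = rip x (adj_on D J y).
Proof.
move=> hD c0 JL Jc; have [D0 DD Dc] := hD.
have [|||z [Dz zP]] := @riesz R H D (fun x => rip (J x) y) (c * rnorm y).
- exact: closed_subspace_real.
- by move=> a u v Du Dv; rewrite JL// !ripE.
- move=> u Du; apply: le_trans (ler_norm _) _; apply: le_trans (rip_le _ _) _.
  by rewrite mulrAC ler_wpM2r ?rnorm_ge0// Jc.
have JZ (a : R[i]) x : D x -> J (a *: x) = a *: J x.
  move=> Dx; have J0 : J 0 = 0.
    have := JL (-1) 0 0 D0 D0; rewrite scaler0 addr0 scaleN1r.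
    by rewrite addNr.
  by rewrite -[a *: x]addr0 JL// J0 addr0.
have DZ (a : R[i]) x : D x -> D (a *: x).
  by move=> Dx; rewrite -[a *: x]addr0; exact: DD.
have zC x : D x -> '[J x, y] = '[x, z].
  move=> Dx; rewrite !innerE zP//; congr (_ +i* _).
  rewrite rip_conjZ -JZ// -zP; last exact: DZ.
  by rewrite -rip_conjZ.
have : [set z | D z /\ forall x, D x -> '[J x, y] = '[x, z]]
    (adj_on D J y).
  by apply: getPex; exists z; split=> //; exact: Dc.
move=> [Dadj adjP]; split=> // x Dx.
by rewrite /rip adjP.
Qed.

Lemma adjP H K (T : 'B(H, K)) x y : rip (T x) y = rip x (adj T y).
Proof.
have [c c0 Tc] := op_bounded T.
have [_ h] := @adj_onP H K setT T c y (@closed_subspaceT H) (ltW c0)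
  (fun a x x' _ _ => opL T a x x') (fun x _ => Tc x).
exact: h.
Qed.

Lemma adjP' H K (T : 'B(H, K)) x y : rip y (T x) = rip (adj T y) x.
Proof. by rewrite ripC adjP ripC. Qed.

Lemma adj_unique H K (T : 'B(H, K)) y z :
  (forall x, rip (T x) y = rip x z) -> adj T y = z.
Proof. by move=> h; apply: rip_ext => x; rewrite -adjP h. Qed.

Lemma adj_linear H K (T : 'B(H, K)) : linear (adj T).
Proof.
move=> a x y; apply: adj_unique => z.
by rewrite !ripDr !rip_conjZ -[_ *: T z]linearZ !adjP.
Qed.

Lemma adj_bounded H K (T : 'B(H, K)) : rbounded (adj T).
Proof.
have [c c0 Tc] := op_bounded T; exists c => // y.
apply: rnorm_le_rip => [|x]; first by rewrite mulr_ge0 ?rnorm_ge0// ltW.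
rewrite ripC -adjP; apply: le_trans (ler_norm _) (le_trans (rip_le _ _) _).
by rewrite mulrAC ler_wpM2r// rnorm_ge0.
Qed.

HB.instance Definition _ H K (T : 'B(H, K)) :=
  GRing.isLinear.Build R[i] K H *:%R (adj T) (adj_linear T).
HB.instance Definition _ H K (T : 'B(H, K)) :=
  isContinuous.Build K H (adj T)
    (rbounded_continuous (adj_linear T) (adj_bounded T)).

Lemma adjK H K (T : 'B(H, K)) : adj (adj T) =1 T.
Proof. by move=> x; apply: adj_unique => y; rewrite ripC -adjP ripC. Qed.

Lemma comp_linear H K L (S : 'B(K, L)) (T : 'B(H, K)) : linear (S \o T).
Proof. by move=> a x y /=; rewrite !linearP. Qed.

Lemma comp_bounded H K L (S : 'B(K, L)) (T : 'B(H, K)) : rbounded (S \o T).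
Proof.
have [c c0 Tc] := op_bounded T; have [d d0 Sd] := op_bounded S.
exists (d * c) => [|x]; first exact: mulr_gt0.
by apply: le_trans (Sd _) _; rewrite -mulrA ler_wpM2l// ltW.
Qed.

Definition opcomp H K L (S : 'B(K, L)) (T : 'B(H, K)) : 'B(H, L) :=
  bop (comp_linear S T) (comp_bounded S T).

Lemma lincomb_linear H K (a b : R) (S T : 'B(H, K)) :
  linear (fun x => a%:C *: S x + b%:C *: T x).
Proof.
move=> k x y /=; rewrite (opL S) (opL T) !scalerDr !scalerA ![k * _]mulrC.
by rewrite addrACA.
Qed.

Lemma lincomb_bounded H K (a b : R) (S T : 'B(H, K)) :
  rbounded (fun x => a%:C *: S x + b%:C *: T x).
Proof.
have [c c0 Tc] := op_bounded T; have [d d0 Sd] := op_bounded S.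
exists (`|a| * d + `|b| * c + 1) => [|x].
  by rewrite ltr_wpDl// addr_ge0// mulr_ge0// ltW.
apply: le_trans (rnormD _ _) _; rewrite !rnormZ !mulrDl -!mulrA mul1r.
apply: ler_wpDr; first exact: rnorm_ge0.
by apply: lerD; rewrite ler_wpM2l.
Qed.

(** Sums, differences and real multiples of operators are all instances. *)
Definition oplin H K (a b : R) (S T : 'B(H, K)) : 'B(H, K) :=
  bop (lincomb_linear a b S T) (lincomb_bounded a b S T).

Lemma id_bounded H : rbounded (fun x : H => x).
Proof. by exists 1 => // x; rewrite mul1r. Qed.

Definition op1 H : 'B(H) := bop (fun a x y => erefl) (@id_bounded H).

(** If [|Q x| <= |P x|], then [P x |-> <Q x, l>] is a bounded functional on the
    range of [P] for each [l]; its representing vector is [G^* l], taken in the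
    closure of the range. The last property says that [G] vanishes on the
    orthogonal complement of the range of [P]. *)
Lemma douglas H K L (P : 'B(H, K)) (Q : 'B(H, L)) :
  (forall x, rip (Q x) (Q x) <= rip (P x) (P x)) ->
  exists G : 'B(K, L), [/\ forall x, G (P x) = Q x,
    forall k, rip (G k) (G k) <= rip k k &
    forall l, closure (range P) (adj G l)].
Proof.
move=> QP; set D := range P.
have PQ0 x x' : P x = P x' -> Q x = Q x'.
  move=> e; apply/eqP; rewrite -subr_eq0 -raddfB; apply/eqP/rip_eq0.
  apply/eqP; rewrite eq_le rip_ge0 andbT; apply: le_trans (QP _) _.
  by rewrite raddfB /= e subrr rip0l.
have D0 : D 0 by exists 0 => //; rewrite raddf0.
have DD (a : R[i]) x y : D x -> D y -> D (a *: x + y).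
  by move=> [u _ <-] [v _ <-]; exists (a *: u + v) => //; rewrite linearP.
pose pre k := get [set x | P x = k].
have preP x : Q (pre (P x)) = Q x.
  by apply: PQ0; apply: (@getPex _ [set y | P y = P x]); exists x.
have ex l : exists z, closure D z /\ forall x, rip (P x) z = rip (Q x) l.
  have [|||z [Dz zP]] := @riesz R K D (fun k => rip (Q (pre k)) l) (rnorm l).
  - by split=> [|a x y]; [exact: D0|exact: DD].
  - move=> a _ _ [u _ <-] [v _ <-]; rewrite -linearP !preP linearP.
    by rewrite !ripE.
  - move=> _ [u _ <-]; rewrite preP mulrC.
    apply: le_trans (ler_norm _) (le_trans (rip_le _ _) _).
    by rewrite ler_wpM2r ?rnorm_ge0// rnorm_le.
  by exists z; split=> // x; rewrite zP ?preP//; exists x.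
have [f fP] := choice ex.
have [_ cDD _] := closed_subspace_closure D0 DD.
have uniq z z' : closure D z -> closure D z' ->
    (forall x, rip (P x) z = rip (P x) z') -> z = z'.
  move=> Dz Dz' zz'; apply/eqP; rewrite -subr_eq0; apply/eqP/rip_eq0.
  have Dzz : closure D (z - z') by rewrite addrC -scaleN1r; exact: cDD.
  rewrite ripDr ripNr (@closure_rip_eq R K D (z - z') z z') ?subrr//.
  by move=> _ [x _ <-].
have fl : linear f.
  move=> a l l'; have [Dl lP] := fP l; have [Dl' lP'] := fP l'.
  have [Dll llP] := fP (a *: l + l'); apply: uniq => //; first exact: cDD.
  move=> x; rewrite llP !ripDr lP' !rip_conjZ; congr (_ + _).
  by rewrite -!linearZ lP.
have f1 l : rnorm (f l) <= rnorm l.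
  have [Dl lP] := fP l; have [-> |f0] := eqVneq (f l) 0.
    by rewrite rnorm0 rnorm_ge0.
  have fgt : 0 < rnorm (f l).
    by rewrite lt_neqAle rnorm_ge0 andbT eq_sym; apply: contra_neq f0 => /rnorm_eq0.
  rewrite -(ler_pM2r fgt) -expr2 rnormE.
  apply: (@closure_rip_le R K D _ _ (rnorm l)) => //; first exact: rnorm_ge0.
  move=> _ [x _ <-]; rewrite lP mulrC.
  apply: le_trans (ler_norm _) (le_trans (rip_le _ _) _).
  by rewrite ler_wpM2r ?rnorm_ge0// rnorm_le.
have fb : rbounded f by exists 1 => // l; rewrite mul1r.
pose F := bop fl fb; exists (adj F); split.
- move=> x; apply: adj_unique => l.
  by rewrite ripC [LHS](fP l).2 ripC.
- move=> k; rewrite -rnorm_le; apply: rnorm_le_rip => [|l]; first exact: rnorm_ge0.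
  rewrite ripC -adjP; apply: le_trans (ler_norm _) (le_trans (rip_le _ _) _).
  by rewrite mulrC ler_wpM2l ?rnorm_ge0// f1.
- by move=> l; rewrite adjK; exact: (fP l).1.
Qed.

Lemma contraction_adj H K (G : 'B(H, K)) :
  (forall k, rip (G k) (G k) <= rip k k) ->
  forall k, rip (adj G k) (adj G k) <= rip k k.
Proof.
move=> G1 l; rewrite -rnorm_le; apply: rnorm_le_rip => [|x]; first exact: rnorm_ge0.
rewrite ripC -adjP; apply: le_trans (ler_norm _) (le_trans (rip_le _ _) _).
by rewrite mulrC ler_wpM2l ?rnorm_ge0// rnorm_le.
Qed.

(** Because [|G^* G x - x|^2 <= |G x|^2 - 2 |G x|^2 + |x|^2 = 0]. *)
Lemma contraction_isometric_at H K (G : 'B(H, K)) x :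
  (forall k, rip (G k) (G k) <= rip k k) ->
  rip (G x) (G x) = rip x x -> adj G (G x) = x.
Proof.
move=> G1 Gx; apply/eqP; rewrite -subr_eq0; apply/eqP/rip_eq0/eqP.
rewrite eq_le rip_ge0 andbT rip_sub_sqr -(adjP' G x (G x)) Gx.
by have := contraction_adj G1 (G x); rewrite Gx; lra.
Qed.

Lemma adj_fixed_closure H K (G : 'B(H, K)) (D : set H) :
  (forall x, D x -> adj G (G x) = x) ->
  forall x, closure D x -> adj G (G x) = x.
Proof.
move=> h x Dx; apply: rip_ext => w.
rewrite -adjP (adjP' G x (G w)) ripC [RHS]ripC.
apply: closure_rip_eq Dx => y Dy.
by rewrite -adjP (adjP' G w (G y)) h.
Qed.

End Adjoint.

(** * Positive operators and square roots *)

Section Positive.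
Context {R : realType}.
Implicit Types H K L : hilbertType R.

Definition selfadjoint H (A : H -> H) : Prop :=
  forall x y, rip (A x) y = rip x (A y).

(** Over the complex numbers polarization makes a positive operator
    selfadjoint. *)
Lemma positiveP H (A : H -> H) : linear A ->
  positive A <-> selfadjoint A /\ forall x, 0 <= rip (A x) x.
Proof.
move=> Al; pose AL : {linear H -> H} := HB.pack A (GRing.isLinear.Build _ _ _ _ A Al).
have AD x y : A (x + y) = A x + A y by exact: (linearD AL).
have AZ a x : A (a *: x) = a *: A x by exact: (linearZ_LR AL).
have ge0E x : (0 <= '[A x, x]) = (rip (A x) ('i *: x) == 0) && (0 <= rip (A x) x).
  by rewrite lecE inner_Im.
split=> [Ap|[As A0] x]; last first.
  rewrite ge0E A0 andbT; apply/eqP.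
  by have := As ('i *: x) x; rewrite AZ !ripJl (ripC x) ripJl; lra.
have h1 x : rip (A x) ('i *: x) = 0 by have := Ap x; rewrite ge0E => /andP[/eqP].
have h2 x : 0 <= rip (A x) x by have := Ap x; rewrite ge0E => /andP[].
split=> // x y.
have := h1 (x - 'i *: y).
have -> : 'i *: (x - 'i *: y) = 'i *: x + y.
  by rewrite scalerBr scalerA -expr2 sqr_i scaleN1r opprK.
rewrite -scaleNr AD AZ scaleNr !ripE h1 ripJl ripJl.
rewrite scalerA -expr2 sqr_i scaleN1r ripNr.
have := h1 y; rewrite (ripC (A y) x); lra.
Qed.

(** Cauchy-Schwarz for the form of [Z], applied to [x] and [Z x]. *)
Lemma positive_contraction H (Z : 'B(H)) : selfadjoint Z ->
  (forall x, 0 <= rip (Z x) x) -> (forall x, rip (Z x) x <= rip x x) ->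
  forall x, rip (Z x) (Z x) <= rip x x.
Proof.
move=> Zs Z0 Z1 x.
have CS u v : rip (Z u) v ^+ 2 <= rip (Z u) u * rip (Z v) v.
  apply: discriminant_le (Z0 v) _ => t.
  have := Z0 (u + t%:C *: v); rewrite linearD linearZ /= !ripE.
  by rewrite (Zs v u) (ripC v (Z u)); congr (_ <= _); ring.
have CSx := CS x (Z x); set a := rip (Z x) (Z x) in CSx *.
have h1 : rip (Z x) x * rip (Z (Z x)) (Z x) <= rip x x * a.
  by apply: ler_pM.
have a0 : 0 <= a by exact: rip_ge0.
have [->|a1] := eqVneq a 0; first by rewrite rip_ge0.
have ap : 0 < a by rewrite lt_neqAle eq_sym a1 a0.
by rewrite -(ler_pM2r ap) -expr2; exact: le_trans h1.
Qed.

Lemma rcvg_rip H (u : nat -> H) l y :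
  rcvg u l -> rip (u n) y @[n --> \oo] --> rip l y.
Proof.
move=> ul; apply/cvgrPdist_le => e e0.
have n1 : 0 < rnorm y + 1 by rewrite ltr_wpDl// rnorm_ge0.
have [N hN] := ul _ (divr_gt0 e0 n1); exists N => // n /= Nn.
rewrite -ripNl -ripDl; apply: le_trans (rip_le _ _) _.
have := hN n Nn; rewrite rnormB ler_pdivlMr// => /(le_trans _); apply.
by rewrite ler_wpM2l ?rnorm_ge0// lerDl.
Qed.

Lemma rcvg_unique H (u : nat -> H) l l' : rcvg u l -> rcvg u l' -> l = l'.
Proof. by move=> /rcvgP ul /rcvgP ul'; exact: (cvg_unique _ ul ul'). Qed.

Section SquareRoot.
Variables (H : hilbertType R) (Z : 'B(H)).
Hypotheses (Zs : selfadjoint Z) (Z1 : forall x, rip (Z x) (Z x) <= rip x x).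

(** Evaluation of a real polynomial at the operator [Z]. *)
Let pev (p : {poly R}) (x : H) : H := \sum_(i < size p) (p`_i)%:C *: iter i Z x.

Let pev_widen n (p : {poly R}) x : (size p <= n)%N ->
  pev p x = \sum_(i < n) (p`_i)%:C *: iter i Z x.
Proof.
move=> pn; rewrite /pev (big_ord_widen n (fun i => (p`_i)%:C *: iter i Z x))//.
rewrite big_mkcond; apply: eq_bigr => i _; case: ltnP => // pi.
by rewrite nth_default// scale0r.
Qed.

Let pevD (p q : {poly R}) x : pev (p + q) x = pev p x + pev q x.
Proof.
pose n := maxn (size p) (size q).
rewrite !(@pev_widen n) ?leq_maxl ?leq_maxr ?size_polyD// -big_split.
by apply: eq_bigr => i _; rewrite coefD rmorphD scalerDl.
Qed.

Let pevZ a (p : {poly R}) x : pev (a *: p) x = a%:C *: pev p x.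
Proof.
rewrite !(@pev_widen (size p)) ?size_scale_leq// scaler_sumr.
by apply: eq_bigr => i _; rewrite coefZ rmorphM scalerA.
Qed.

Let pevMX (p : {poly R}) x : pev (p * 'X) x = Z (pev p x).
Proof.
rewrite (@pev_widen (size p).+1); last first.
  by apply: leq_trans (size_polyMleq _ _) _; rewrite size_polyX addn2.
rewrite big_ord_recl coefMX /= scale0r add0r /pev linear_sum.
by apply: eq_bigr => i _; rewrite coefMX linearZ.
Qed.

Let pevC c x : pev c%:P x = c%:C *: x.
Proof.
by rewrite (@pev_widen 1) ?size_polyC ?leq_b1// big_ord1 coefC.
Qed.

Let pevX x : pev 'X x = Z x.
Proof. by rewrite -['X]mul1r pevMX pevC scale1r. Qed.

Let pevM (p q : {poly R}) x : pev (p * q) x = pev p (pev q x).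
Proof.
elim/poly_ind: p => [|p c IH].
  by rewrite mul0r /pev size_poly0 !big_ord0.
rewrite mulrDl mulrAC mul_polyC !pevD !pevMX pevZ pevC.
by rewrite IH.
Qed.

Let iter_linear n : linear (iter n Z).
Proof. by elim: n => [//|n IH] a x y; rewrite !iterS IH linearP. Qed.

Let pev_linear p : linear (pev p).
Proof.
move=> a x y; rewrite /pev scaler_sumr -big_split; apply: eq_bigr => i _ /=.
by rewrite iter_linear scalerDr !scalerA mulrC.
Qed.

Let pev_selfadjoint p : selfadjoint (pev p).
Proof.
have iters n : selfadjoint (iter n Z).
  by elim: n => [//|n IH] x y; rewrite iterS Zs IH -iterSr.
move=> x y; rewrite /pev; elim/big_rec2: _ => [|i u v _ IH].
  by rewrite rip0l rip0r.
by rewrite !ripE iters IH.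
Qed.

Let nneg (p : {poly R}) := forall i, 0 <= p`_i.

(** Nonnegative coefficients make the value at [1] a bound for the norm, because
    [Z] is a contraction. *)
Let pev_bound p x : nneg p -> rnorm (pev p x) <= p.[1] * rnorm x.
Proof.
move=> p0; have iter1 n : rnorm (iter n Z x) <= rnorm x.
  by elim: n => [//|n IH]; rewrite iterS; apply: le_trans IH; rewrite rnorm_le.
rewrite horner_coef mulr_suml /pev.
apply: (big_rec2 (fun (u : H) (v : R) => rnorm u <= v)) => [|i v u _ IH].
  by rewrite rnorm0.
apply: le_trans (rnormD _ _) _; rewrite lerD// rnormZ expr1n mulr1 ger0_norm//.
by rewrite ler_wpM2l.
Qed.

(** Picard iteration for [Y = (Z + Y^2) / 2], the equation solved by
    [Y = I - (I - Z)^(1/2)]. *)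
Let pk : nat -> {poly R} := fix pk n :=
  if n is m.+1 then 2^-1 *: ('X + pk m * pk m) else 0.

Let nnegD p q : nneg p -> nneg q -> nneg (p + q).
Proof. by move=> hp hq i; rewrite coefD addr_ge0. Qed.
Let nnegM p q : nneg p -> nneg q -> nneg (p * q).
Proof.
by move=> hp hq i; rewrite coefM; apply: sumr_ge0 => j _; rewrite mulr_ge0.
Qed.
Let nnegZ a p : 0 <= a -> nneg p -> nneg (a *: p).
Proof. by move=> a0 hp i; rewrite coefZ mulr_ge0. Qed.
Let nnegX : nneg 'X.
Proof. by move=> i; rewrite coefX ler0n. Qed.
Let nneg0 : nneg 0.
Proof. by move=> i; rewrite coef0. Qed.

Let p_nneg n : nneg (pk n).
Proof.
elim: n => [|n IH] /=; first exact: nneg0.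
by apply: nnegZ; [|apply: nnegD; [exact: nnegX|exact: nnegM]].
Qed.

(** The increments of the iteration keep nonnegative coefficients, so the
    convergence of the real numbers [(pk n).[1]] forces that of
    [pev (pk n) x]. *)
Let dp_nneg n : nneg (pk n.+1 - pk n).
Proof.
elim: n => [|n IH].
  rewrite /= subr0 mulr0 addr0; exact: nnegZ nnegX.
have -> : pk n.+2 - pk n.+1 = 2^-1 *: ((pk n.+1 - pk n) * (pk n.+1 + pk n)).
  transitivity (2^-1 *: ('X + pk n.+1 * pk n.+1) - 2^-1 *: ('X + pk n * pk n)) => //.
  by rewrite -scalerBr; congr (_ *: _); ring.
apply: nnegZ => //; apply: nnegM => //; exact: nnegD.
Qed.

Let dp_nneg_le m n : (m <= n)%N -> nneg (pk n - pk m).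
Proof.
move/subnK <-; elim: (n - m)%N => [|k IH]; first by rewrite subrr; exact: nneg0.
by rewrite addSn -(subrKA (pk (k + m))); apply: nnegD.
Qed.

Let q n := (pk n).[1].

Let q_le1 n : 0 <= q n <= 1.
Proof.
elim: n => [|n IH]; first by rewrite /q horner0 lexx ler01.
rewrite /q /= !hornerE -/(q n); case/andP: IH => q0 q1.
have : q n * q n <= 1 * 1 by rewrite ler_pM.
have : 0 <= q n * q n by rewrite mulr_ge0.
lra.
Qed.

Let q_nd : nondecreasing_seq q.
Proof.
move=> m n mn; rewrite -subr_ge0 /q -hornerN -hornerD horner_coef.
by apply: sumr_ge0 => i _; rewrite expr1n mulr1; exact: dp_nneg_le.
Qed.

Let q_cauchy (e : R) : 0 < e -> exists N, forall n, (N <= n)%N -> q n - q N <= e.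
Proof.
move=> e0; have qc : cvgn q.
  apply: nondecreasing_is_cvgn => //; exists 1 => _ [n _ <-].
  by case/andP: (q_le1 n).
have /cvgrPdist_le /(_ e e0) [N _ hN] := qc.
exists N => n Nn; have /= := hN N (leqnn N); have := nondecreasing_cvgn_le q_nd qc n.
by rewrite ler_norml; lra.
Qed.

Let pev_cauchy x : rcauchy (fun n => pev (pk n) x).
Proof.
have key m n : (m <= n)%N ->
    rnorm (pev (pk n) x - pev (pk m) x) <= (q n - q m) * rnorm x.
  move=> mn; have -> : pev (pk n) x - pev (pk m) x = pev (pk n - pk m) x.
    by rewrite -[- pk m]scaleN1r pevD pevZ rmorphN1 scaleN1r.
  apply: le_trans (pev_bound _ (dp_nneg_le mn)) _.
  by rewrite hornerD hornerN.
move=> e e0; have d0 : 0 < e / 2 / (rnorm x + 1).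
  by rewrite !divr_gt0// ltr_wpDl// rnorm_ge0.
have [N hN] := q_cauchy d0.
have keyN n : (N <= n)%N -> rnorm (pev (pk n) x - pev (pk N) x) <= e / 2.
  move=> Nn; apply: le_trans (key _ _ Nn) _.
  apply: le_trans (ler_wpM2r (rnorm_ge0 _) (hN n Nn)) _.
  rewrite mulrAC ler_pdivrMr ?ltr_wpDl ?rnorm_ge0//.
  by rewrite ler_wpM2l ?lerDl// divr_ge0// ltW.
exists N => m n Nm Nn; rewrite -(subrKA (pev (pk N) x)) [leRHS]splitr.
by apply: le_trans (rnormD _ _) _; rewrite lerD ?keyN// rnormB keyN.
Qed.

(** [I - Y] is then a square root of [I - Z]. *)
Lemma sqrt_iteration : exists Y : 'B(H), [/\ selfadjoint Y,
  forall x, rip (Y x) (Y x) <= rip x x &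
  forall x, 2%:C *: Y x = Z x + Y (Y x)].
Proof.
have [Y hY] := choice (fun x => rcauchy_rcvg (pev_cauchy x)).
have pY1 n x : rnorm (pev (pk n) x) <= rnorm x.
  apply: le_trans (pev_bound _ (p_nneg n)) _.
  by rewrite ler_piMl ?rnorm_ge0//; case/andP: (q_le1 n).
have Y1 x : rnorm (Y x) <= rnorm x.
  rewrite -[Y x]subr0; apply: rcvg_le (hY x) _.
  by exists 0%N => // n _ /=; rewrite subr0.
have Yl : linear Y.
  move=> a x y; apply: (rcvg_unique (u := fun n => pev (pk n) (a *: x + y))) => //.
  apply/rcvgP; under eq_fun do rewrite pev_linear.
  by apply: cvgD; [apply: cvgZr|]; apply/rcvgP.
have Yb : rbounded Y by exists 1 => // x; rewrite mul1r.
exists (bop Yl Yb); split=> [x y|x|x] /=.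
- have h1 := rcvg_rip (y := y) (hY x); have h2 := rcvg_rip (y := x) (hY y).
  have E : (fun n => rip (pev (pk n) y) x) = (fun n => rip (pev (pk n) x) y).
    by apply/funext => n; rewrite ripC -pev_selfadjoint.
  rewrite E in h2; rewrite [RHS]ripC; exact: (cvg_unique _ h1 h2).
- by rewrite -rnorm_le.
- apply: (rcvg_unique (u := fun n => 2%:C *: pev (pk n.+1) x)).
    apply/rcvgP; apply: cvgZr; apply/rcvgP => e e0; have [N hN] := hY x e e0.
    by exists N => n Nn; apply: hN; exact: leqW.
  have E n : 2%:C *: pev (pk n.+1) x = Z x + pev (pk n) (pev (pk n) x).
    by rewrite /= pevZ scalerA -rmorphM divff// scale1r pevD pevX pevM.
  under eq_fun do rewrite E.
  apply/rcvgP; apply: cvgD; first exact: cvg_cst.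
  apply/rcvgP => e e0; have e2 : 0 < e / 2 by rewrite divr_gt0.
  have [N hN] := hY x _ e2; have [M hM] := hY (Y x) _ e2.
  exists (maxn N M) => n; rewrite geq_max => /andP[Nn Mn].
  rewrite -(subrKA (pev (pk n) (Y x))) [leRHS]splitr.
  apply: le_trans (rnormD _ _) _; apply: lerD; last exact: hM.
  have -> : pev (pk n) (pev (pk n) x) - pev (pk n) (Y x) = pev (pk n) (pev (pk n) x - Y x).
    by rewrite -scaleN1r addrC -pev_linear scaleN1r addrC.
  by apply: le_trans (pY1 _ _) _; exact: hN.
Qed.

End SquareRoot.
End Positive.

Section SquareRootTheory.
Context {R : realType}.
Implicit Types H K L : hilbertType R.

Lemma oplinB H K (S T : 'B(H, K)) x : oplin 1 (-1) S T x = S x - T x.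
Proof. by rewrite [LHS]/= scale1r rmorphN1 scaleN1r. Qed.

Lemma oplinZ H K (a : R) (T : 'B(H, K)) x : oplin a 0 T T x = a%:C *: T x.
Proof. by rewrite [LHS]/= scale0r addr0. Qed.

Lemma positive_sqrt H (A : 'B(H)) : selfadjoint A ->
  (forall x, 0 <= rip (A x) x) -> (forall x, rip (A x) x <= rip x x) ->
  exists B : 'B(H), [/\ selfadjoint B, forall x, 0 <= rip (B x) x &
    forall x, B (B x) = A x].
Proof.
move=> As A0 A1; pose Z := oplin 1 (-1) (op1 H) A.
have ZE x : Z x = x - A x by exact: oplinB.
have Zs : selfadjoint Z by move=> x y; rewrite !ZE !ripE As.
have Z0 x : 0 <= rip (Z x) x by rewrite ZE ripDl ripNl subr_ge0.
have Z1 x : rip (Z x) x <= rip x x by rewrite ZE ripDl ripNl gerBl.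
have [Y [Ys Y1 YE]] := sqrt_iteration Zs (positive_contraction Zs Z0 Z1).
pose B := oplin 1 (-1) (op1 H) Y.
have BE x : B x = x - Y x by exact: oplinB.
exists B; split=> [x y|x|x].
- by rewrite !BE !ripE Ys.
- rewrite BE ripDl ripNl subr_ge0; apply: le_trans (ler_norm _) (le_trans (rip_le _ _) _).
  by rewrite -rnormE expr2 ler_wpM2r ?rnorm_ge0// rnorm_le.
- rewrite !BE linearB /=.
  have -> : x - Y x - (Y x - Y (Y x)) = x - 2%:C *: Y x + Y (Y x).
    by rewrite (rmorph_nat (real_complex R) 2) scaler_nat mulr2n !opprB opprD !addrA addrAC.
  by rewrite YE ZE !opprD opprK !addrA subrr add0r subrK.
Qed.

Lemma positive_op H (A : 'B(H)) :
  positive A <-> selfadjoint A /\ forall x, 0 <= rip (A x) x.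
Proof. exact/positiveP/opL. Qed.

(** Scaling brings any positive operator below the identity. *)
Lemma positive_factor H (A : 'B(H)) : positive A ->
  exists B : 'B(H), forall x y, rip (B x) (B y) = rip (A x) y.
Proof.
move=> /positive_op[As A0]; have [c c0 Ac] := op_bounded A.
pose A' := oplin c^-1 0 A A; have A'E x : A' x = (c^-1)%:C *: A x by exact: oplinZ.
have [||| B [Bs B0 BE]] := @positive_sqrt H A'.
- by move=> x y; rewrite !A'E !ripE As.
- by move=> x; rewrite A'E ripZl mulr_ge0// invr_ge0 ltW.
- move=> x; rewrite A'E ripZl mulrC ler_pdivrMr//.
  apply: le_trans (ler_norm _) (le_trans (rip_le _ _) _).
  by rewrite -rnormE expr2 mulrAC ler_wpM2r ?rnorm_ge0// mulrC.
exists (oplin (Num.sqrt c) 0 B B) => x y; rewrite !oplinZ !ripE Bs BE A'E ripZr.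
by rewrite !mulrA -expr2 sqr_sqrtr ?ltW// divff ?gt_eqF// mul1r As.
Qed.

(** Any positive square root [B] of [A] shows that the function picked by [get] in
    [op_sqrt A] has its defining properties. *)
Lemma op_sqrtP H (A B : 'B(H)) : selfadjoint B ->
  (forall x, 0 <= rip (B x) x) -> (forall x, B (B x) = A x) ->
  [/\ linear (op_sqrt A), continuous (op_sqrt A), positive (op_sqrt A) &
      op_sqrt A \o op_sqrt A =1 A].
Proof.
move=> Bs B0 BE; apply: (@getPex _ [set B : H -> H |
    [/\ linear B, continuous B, positive B & B \o B =1 A]]).
exists (B : H -> H); split=> //; first exact: opL.
- exact: cts_fun.
- exact/positive_op.
Qed.

(** The couplings use [D_C^2 = I - C^* C] in this polarized form. *)
Lemma defect_opP H K (C : 'B(H, K)) : contraction_op C ->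
  exists D : 'B(H), [/\ defect_op C = D, selfadjoint D &
    forall x y, rip (D x) (D y) = rip x y - rip (C x) (C y)].
Proof.
move=> C1; pose A := oplin 1 (-1) (op1 H) (opcomp (adj C) C).
have AE : (fun x => x - adj C (C x)) = A by apply/funext => x; rewrite /A oplinB.
have Arip x y : rip (A x) y = rip x y - rip (C x) (C y).
  by rewrite -AE ripDl ripNl -adjP'.
have As : selfadjoint A by move=> x y; rewrite Arip -AE ripDr ripNr -adjP.
have [||B [Bs B0 BE]] := positive_sqrt As.
- by move=> x; rewrite Arip subr_ge0 -le_rnorm.
- by move=> x; rewrite Arip gerBl rip_ge0.
have [Sl Sc Sp SE] := op_sqrtP Bs B0 BE.
pose D := bop Sl (continuous_rbounded Sl Sc); exists D.
have DE : defect_op C = D by rewrite /defect_op AE.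
have Ds : selfadjoint D by have [] := (positive_op D).1 Sp.
split=> // x y; rewrite -Ds -Arip; congr (rip _ _); exact: SE.
Qed.

End SquareRootTheory.

(** * Operators dominating [Delta T] *)

Section TwoIsometries.
Context {R : realType}.
Implicit Types H K L : hilbertType R.

Lemma isometry_rip H K (V : 'B(H, K)) : isometry_op V ->
  forall x y, rip (V x) (V y) = rip x y.
Proof.
move=> Vi x y; have V2 z : rip (V z) (V z) = rip z z by apply/eq_rnorm/Vi.
have := V2 (x + y); rewrite linearD !rip_add_sqr !V2; lra.
Qed.

Lemma isometry_adjK H K (V : 'B(H, K)) : isometry_op V -> cancel V (adj V).
Proof. by move=> Vi x; apply: adj_unique => y; rewrite isometry_rip. Qed.

Lemma isometry_adj_le H K (V : 'B(H, K)) : isometry_op V ->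
  forall k, rip (adj V k) (adj V k) <= rip k k.
Proof.
by move=> Vi; apply: contraction_adj => k; rewrite isometry_rip.
Qed.

Lemma orthcP H K (V : 'B(H, K)) k : orthc (range V) k <-> adj V k = 0.
Proof.
split=> [ok|Vk a [x _ <-]].
  by apply: adj_unique => x; rewrite rip0r ripC /rip ok// ; exists x.
have h y : rip k (V y) = 0 by rewrite adjP' Vk rip0l.
by rewrite innerE -linearZ !h.
Qed.

Lemma polarization H (b : H -> H -> R) :
  (forall x y z, b (x + y) z = b x z + b y z) -> (forall x y, b x y = b y x) ->
  (forall x, b x x = 0) -> forall x y, b x y = 0.
Proof.
move=> bD bC b0 x y; have := b0 (x + y).
by rewrite bD !(bC _ (x + y)) !bD !b0 (bC y x); lra.
Qed.

(** The real part of the sesquilinear form of [Delta S]. *)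
Definition dform H (S : H -> H) (x y : H) : R := rip (S x) (S y) - rip x y.

(** [Delta S] as a bounded operator. *)
Definition DeltaB H (S : 'B(H)) : 'B(H) :=
  oplin 1 (-1) (opcomp (adj S) S) (op1 H).

Lemma DeltaBE H (S : 'B(H)) : Delta S = DeltaB S.
Proof. by apply/funext => x; rewrite /DeltaB oplinB. Qed.

Lemma rip_Delta H (S : 'B(H)) x y : rip (Delta S x) y = dform S x y.
Proof. by rewrite /Delta ripDl ripNl -adjP'. Qed.

Lemma dformC H (S : H -> H) x y : dform S x y = dform S y x.
Proof. by rewrite /dform ripC (ripC x). Qed.

Lemma dformDl H (S : 'B(H)) x y z : dform S (x + y) z = dform S x z + dform S y z.
Proof. by rewrite /dform linearD !ripDl; ring. Qed.

Lemma dformDr H (S : 'B(H)) x y z : dform S z (x + y) = dform S z x + dform S z y.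
Proof. by rewrite dformC dformDl !(dformC _ _ z). Qed.

Lemma two_isometryP H (S : 'B(H)) :
  two_isometry S <-> forall x y, dform S (S x) (S y) = dform S x y.
Proof.
have two (x : H) : 2 *: x = 2%:C *: x by rewrite (rmorph_nat (real_complex R) 2).
have E x y : rip (adj S (adj S (S (S x))) - 2 *: adj S (S x) + x) y =
    dform S (S x) (S y) - dform S x y.
  by rewrite two !ripE -!adjP' /dform; ring.
split=> [h x y|h x]; first by apply/eqP; rewrite -subr_eq0 -E h rip0l.
by apply: rip_ext => y; rewrite ripC E h subrr rip0r.
Qed.

Lemma dform_iter H (S : 'B(H)) : two_isometry S -> forall n x,
  rip (iter n S x) (iter n S x) = rip x x + n%:R * dform S x x.
Proof.
move=> /two_isometryP S2 n x.
have dn k : dform S (iter k S x) (iter k S x) = dform S x x.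
  by elim: k => [//|k IH]; rewrite !iterS S2.
elim: n => [|n IH]; first by rewrite mul0r addr0.
have := dn n; rewrite {1}/dform -!iterS IH -natr1; lra.
Qed.

(** Otherwise [|S^n x|^2], affine in [n] with slope [dform S x x], would become
    negative. *)
Lemma dform_ge0 H (S : 'B(H)) x : two_isometry S -> 0 <= dform S x x.
Proof.
move=> S2; rewrite leNgt; apply/negP => d0.
have t0 : 0 < - dform S x x by rewrite oppr_gt0.
have := archi_boundP (divr_ge0 (rip_ge0 x) (ltW t0)).
rewrite ltr_pdivrMr//; set n := Num.bound _.
have := rip_ge0 (iter n S x); rewrite dform_iter//; lra.
Qed.

(** [A >= 0], [T^* A T = A] and [Delta T <= A], tested on vectors. The case
    [A = 0] describes contractions. *)
Definition dominates H (A T : 'B(H)) : Prop :=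
  [/\ selfadjoint A, forall x, 0 <= rip (A x) x,
      forall x y, rip (A (T x)) (T y) = rip (A x) y
    & forall x, dform T x x <= rip (A x) x].

Lemma dominatesP H (A T : 'B(H)) :
  dominates A T <-> [/\ positive A, A_isometry A T & op_le (Delta T) A].
Proof.
pose D := oplin 1 (-1) A (DeltaB T).
have DE : A \- Delta T = D.
  by apply/funext => x; rewrite /D oplinB -DeltaBE.
have Drip x y : rip (D x) y = rip (A x) y - dform T x y.
  by rewrite -DE ripDl ripNl rip_Delta.
split=> [[As A0 AT TA]|[/positive_op[As A0] AT]].
  split; first exact/positive_op.
    by move=> x; apply: rip_ext => y; rewrite /= -adjP ripC AT ripC.
  rewrite /op_le DE; apply/positive_op; split=> [x y|x]; last first.
    by rewrite Drip subr_ge0.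
  by rewrite Drip [RHS]ripC Drip As (ripC x) (dformC T).
rewrite /op_le DE => /positive_op[_ D0]; split=> // x.
  by move=> y; rewrite adjP'; congr (rip _ y); exact: AT.
by rewrite -subr_ge0 -Drip.
Qed.

(** The part common to all liftings: positivity and [Delta T <= A] hold for the
    compression [A] of [Delta S], so only the invariance under [T] is left to the
    kind of lifting at hand. *)
Lemma dominates_lifting H K (V : 'B(H, K)) (T A : 'B(H)) (S : 'B(K)) :
  isometry_op V -> adj V \o S =1 T \o adj V -> two_isometry S ->
  (forall x y, rip (A x) y = dform S (V x) (V y)) ->
  (forall x, dform S (V (T x)) (V (T x)) = dform S (V x) (V x)) ->
  dominates A T.
Proof.
move=> Vi VS S2 AE AT; split.
- by move=> x y; rewrite AE (ripC x) AE dformC.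
- by move=> x; rewrite AE dform_ge0.
- move=> x y; apply/eqP; rewrite -subr_eq0; apply/eqP; move: x y.
  apply: polarization => [x y z|x y|x].
  + by rewrite !linearD !ripDl; ring.
  + by rewrite !AE dformC (dformC S (V x)).
  + by rewrite !AE AT subrr.
- move=> x; rewrite AE /dform (isometry_rip Vi) lerB//.
  have -> : T x = adj V (S (V x)).
    by have := VS (V x); rewrite /= isometry_adjK.
  exact: isometry_adj_le.
Qed.

Definition compression H K (V : 'B(H, K)) (S : 'B(K)) : 'B(H) :=
  opcomp (adj V) (opcomp (DeltaB S) V).

Lemma compressionE H K (V : 'B(H, K)) (S : 'B(K)) x y :
  rip (compression V S x) y = dform S (V x) (V y).
Proof. by rewrite /compression /= -adjP' -rip_Delta DeltaBE. Qed.

(** For a lifting of type I, [S V x] and [V T x] differ by a vector of the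
    orthogonal complement, which [Delta S] annihilates. *)
Lemma type_I_dominates H K (V : 'B(H, K)) (T : 'B(H)) (S : 'B(K)) :
  two_isometric_lifting V T S -> type_I V S ->
  dominates (compression V S) T.
Proof.
move=> [[Vi VS] S2] tI.
apply: (@dominates_lifting _ _ V _ _ S) => // [x y|x]; first exact: compressionE.
pose k := S (V x) - V (T x).
have kk : Delta S k = 0.
  apply: tI; apply/orthcP; rewrite linearB /= isometry_adjK//.
  by rewrite [adj V _]VS /= isometry_adjK// subrr.
have k0 y : dform S k y = 0 by rewrite -rip_Delta kk rip0l.
have SV : S (V x) = V (T x) + k by rewrite subrKC.
clearbody k; rewrite -[RHS](two_isometryP S).1// SV dformDl !dformDr.
by rewrite (dformC S (V _) k) !k0 !addr0.
Qed.

(** Expanding [<Delta S (S h), S h>] along [S h = X h + T h], the terms other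
    than [<A T h, T h>] add up to the left-hand side of the matrix condition. *)
Lemma matrix_condition_dominates H K (V : 'B(H, K)) (T : 'B(H)) (S : 'B(K)) :
  two_isometric_lifting V T S -> matrix_condition V T S ->
  dominates (compression V S) T.
Proof.
move=> [[Vi VS] S2] [H' [V' [W [X [[V'i _ V'V _] SE cond]]]]].
apply: (@dominates_lifting _ _ V _ _ S) => // [x y|x]; first exact: compressionE.
have SV h : S (V h) = V' (X h) + V (T h).
  by have := SE 0 h; rewrite !linear0 !add0r.
have SV' a : S (V' a) = V' (W a).
  by have := SE a 0; rewrite !linear0 !addr0.
have oV a h : rip (V' a) (V h) = 0 by rewrite /rip V'V.
have d1 a : dform S (V' a) (V' a) = rip (Delta W a) a.
  by rewrite rip_Delta /dform SV' !(isometry_rip V'i).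
have d2 a h : dform S (V' a) (V h) = rip (W a) (X h).
  by rewrite /dform SV' SV ripDr !oV (isometry_rip V'i) addr0 subr0.
pose Y := opcomp (adj X) (opcomp (adj W) (opcomp X T)).
have c : dform S (V' (X x)) (V' (X x)) + 2 * dform S (V' (X x)) (V (T x)) = 0.
  have := congr1 (fun v => rip v x) (cond x).
  rewrite rip0l ripDl -adjP' d1 d2 => <-; congr (_ + _).
  have -> : 2 *: ReOp (adj X \o adj W \o X \o T) x = Y x + adj Y x.
    by rewrite /ReOp scalerA divff ?scale1r// pnatr_eq0.
  have YE : rip (Y x) x = rip (W (X x)) (X (T x)).
    by rewrite [RHS]ripC (adjP' W) (adjP' X).
  by rewrite ripDl -(adjP' Y) (ripC x) YE; ring.
rewrite -[RHS](two_isometryP S).1// SV dformDl !dformDr.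
by rewrite (dformC S (V (T x)) (V' _)); move: c; lra.
Qed.

End TwoIsometries.

(** * From triangular extensions to dominating operators *)

Section Triangular.
Context {R : realType}.
Implicit Types H K L M : hilbertType R.

Lemma op_norm_le H K (T : H -> K) (c : R) :
  (forall x, rnorm x <= 1 -> rnorm (T x) <= c) -> (T 0 = 0) -> op_norm T <= c.
Proof.
move=> Tc T0; apply: ge_sup.
  by exists (complex.Re `|T 0|); exists 0 => //=; rewrite normr0 ler01.
by move=> _ [x /= x1 <-]; apply: Tc; rewrite -lecR -normE.
Qed.

Section Decomposition.
Variables (M0 M1 M : hilbertType R) (V0 : 'B(M0, M)) (V1 : 'B(M1, M)).
Hypothesis hV : orth_decomp V0 V1.

Lemma orth_decomp_adj x y :
  adj V0 (V0 x + V1 y) = x /\ adj V1 (V0 x + V1 y) = y.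
Proof.
have [V0i V1i V01 _] := hV.
have z a b : rip (V0 a) (V1 b) = 0 by rewrite /rip V01.
split; apply: adj_unique => w; rewrite ripDr.
  by rewrite z (isometry_rip V0i) addr0.
by rewrite (ripC _ (V0 x)) z (isometry_rip V1i) add0r.
Qed.

Lemma orth_decompE m : V0 (adj V0 m) + V1 (adj V1 m) = m.
Proof.
have [_ _ _ /(_ m)[x [y ->]]] := hV.
by have [-> ->] := orth_decomp_adj x y.
Qed.

Lemma orth_decomp_rip x y x' y' :
  rip (V0 x + V1 y) (V0 x' + V1 y') = rip x x' + rip y y'.
Proof.
have [V0i V1i V01 _] := hV.
have z a b : rip (V0 a) (V1 b) = 0 by rewrite /rip V01.
rewrite !ripDl !ripDr z (ripC (V1 _) (V0 _)) z addr0 add0r.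
by rewrite (isometry_rip V0i) (isometry_rip V1i).
Qed.

End Decomposition.

Lemma isometry_on_rip H K (D : set H) (J : H -> K) x :
  isometry_on D J -> D x -> rip (J x) (J x) = rip x x.
Proof. by move=> [_ Ji] Dx; apply/eq_rnorm/Ji. Qed.

Lemma unitary_isometry H (U : 'B(H)) x y : unitary_op U -> rip (U x) (U y) = rip x y.
Proof. by move=> [UU _]; rewrite adjP [adj U _]UU. Qed.

Lemma defect_space_closed H K (C : 'B(H, K)) :
  contraction_op C -> closed_subspace (defect_space C).
Proof.
move=> /defect_opP[D [DE _ _]]; rewrite /defect_space DE.
apply: closed_subspace_closure; first by exists 0 => //; rewrite linear0.
by move=> a _ _ [x _ <-] [y _ <-]; exists (a *: x + y) => //; rewrite linearP.
Qed.

(** Compressing [delta^2 P], with [P] the projection on the unitary part, to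
    [H]. The coupling condition on [C] and [E] enters by completing a square:
    [|m|^2 + delta^2 |y|^2 - |T' m|^2 = |J0 D_C x + delta J1 D_E y|^2]. *)
Lemma triangular_dominates H (T : 'B(H)) (delta : R) :
  triangular_extension T delta ->
  0 < delta /\ exists A : 'B(H), dominates A T /\ op_norm A <= delta ^+ 2.
Proof.
move=> [M [M0 [M1 [V [T' [V0 [V1 [C [E [U]]]]]]]]]].
move=> [[Vi VT] hV T'E [C1 E1 Uu d0]] [M' [J0 [J1 [J0i J1i JCE]]]].
split=> //.
pose Q := opcomp (adj V1) V.
have QE h : Q h = adj V1 (V h) by [].
pose A := oplin (delta ^+ 2) 0 (opcomp (adj Q) Q) (opcomp (adj Q) Q).
have AE x y : rip (A x) y = delta ^+ 2 * rip (Q x) (Q y).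
  by rewrite /A oplinZ ripZl -(adjP' Q).
have Q1 x : rnorm (Q x) <= rnorm x.
  rewrite rnorm_le QE -(isometry_rip Vi x x).
  by apply: isometry_adj_le; case: hV.
have T'V x y : T' (V0 x + V1 y) = V0 (C x + delta%:C *: E y) + V1 (U y) by rewrite T'E.
have QT x : Q (T x) = U (Q x).
  rewrite !QE -[V (T x)]VT /= -[in LHS](orth_decompE hV (V x)) T'V.
  by have [_ ->] := orth_decomp_adj hV
    (C (adj V0 (V x)) + delta%:C *: E (adj V1 (V x))) (U (adj V1 (V x))).
exists A; split; last first.
  apply: op_norm_le => [x x1|]; last by rewrite linear0.
  apply: rnorm_le_rip => [|y]; first exact: sqr_ge0.
  rewrite AE ler_wpM2l ?sqr_ge0//.
  apply: le_trans (ler_norm _) (le_trans (rip_le _ _) _).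
  rewrite -[leRHS]mul1r; apply: ler_pM; rewrite ?rnorm_ge0 ?Q1//.
  exact: le_trans (Q1 x) x1.
split.
- by move=> x y; rewrite AE [RHS]ripC AE ripC.
- by move=> x; rewrite AE mulr_ge0 ?sqr_ge0 ?rip_ge0.
- by move=> x y; rewrite !AE !QT unitary_isometry.
move=> h; rewrite AE QE /dform -(isometry_rip Vi (T h)) -(isometry_rip Vi h).
rewrite -[V (T h)]VT /=.
set x := adj V0 (V h); set y := adj V1 (V h).
have -> : V h = V0 x + V1 y by rewrite /x /y orth_decompE.
rewrite T'V !(orth_decomp_rip hV) unitary_isometry// rip_add_sqr !ripE.
have [DC [DCE DCs DCr]] := defect_opP C1; have [DE [DEE DEs DEr]] := defect_opP E1.
have mem0 u : defect_space C (DC u).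
  by rewrite /defect_space DCE; apply: subset_closure; exists u.
have mem1 u : defect_space E (DE u).
  by rewrite /defect_space DEE; apply: subset_closure; exists u.
have J01 u : defect_space C u -> rnorm (J0 u) <= 1 * rnorm u.
  by move=> Du; rewrite mul1r rnorm_le (isometry_on_rip J0i Du).
have [_ zP] := @adj_onP R _ _ (defect_space C) J0 1 (J1 (DE y))
  (defect_space_closed C1) ler01 J0i.1 J01.
have key : rip (C x) (E y) = - rip (J0 (DC x)) (J1 (DE y)).
  have := JCE y; rewrite DCE DEE addrC => /eqP; rewrite addr_eq0 => /eqP CE.
  by rewrite adjP CE ripNr -DCs zP.
have := rip_ge0 (J0 (DC x) + delta%:C *: J1 (DE y)).
rewrite rip_add_sqr !ripE (isometry_on_rip J0i)// (isometry_on_rip J1i)//.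
rewrite DCr DEr key; lra.
Qed.

End Triangular.

(** * The asymptotic limit of a contraction *)

Section AsymptoticLimit.
Context {R : realType}.
Variables (H : hilbertType R) (T : 'B(H)).
Hypothesis T1 : forall x, rip (T x) (T x) <= rip x x.

Let a (x y : H) (n : nat) : R := rip (iter n T x) (iter n T y).

Let iterP n (c : R[i]) x y : iter n T (c *: x + y) = c *: iter n T x + iter n T y.
Proof. by elim: n => [//|n IH]; rewrite !iterS IH linearP. Qed.

Let iterD n x y : iter n T (x + y) = iter n T x + iter n T y.
Proof. by have := iterP n 1 x y; rewrite !scale1r. Qed.

Let iterZ n (c : R[i]) x : iter n T (c *: x) = c *: iter n T x.
Proof. by elim: n => [//|n IH]; rewrite !iterS IH linearZ. Qed.

Let a_dec x : nonincreasing_seq (a x x).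
Proof. by apply/nonincreasing_seqP => n; rewrite /a !iterS. Qed.

Let a_diag_cvg x : cvgn (a x x).
Proof.
apply: nonincreasing_is_cvgn => //; exists 0 => _ [n _ <-]; exact: rip_ge0.
Qed.

Let a_cvg x y : cvgn (a x y).
Proof.
have -> : a x y = (fun n => 2^-1 * (a (x + y) (x + y) n - a x x n - a y y n)).
  by apply/funext => n; rewrite /a iterD rip_add_sqr; field.
by apply: is_cvgMr; apply: is_cvgB => //; apply: is_cvgB.
Qed.

Let L x y := limn (a x y).

Let aL x y : a x y n @[n --> \oo] --> L x y.
Proof. exact: a_cvg. Qed.

(** The strong limit of [T^*n T^n], obtained from its form. *)
Lemma asymptotic_limit : exists A : 'B(H), forall x y,
  a x y n @[n --> \oo] --> rip (A x) y.
Proof.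
have absL x y : L x y <= rnorm y * rnorm x.
  apply: limr_le => //; apply: nearW => n.
  have it z : rnorm (iter n T z) <= rnorm z.
    by rewrite rnorm_le; have /(_ 0%N n (leq0n n)) := @a_dec z.
  apply: le_trans (ler_norm _) (le_trans (rip_le _ _) _).
  by rewrite mulrC; apply: ler_pM; rewrite ?rnorm_ge0.
have ex x : exists z, forall y, rip y z = L y x.
  have [|||z [_ zP]] := @riesz R H setT (fun y => L y x) (rnorm x).
  - by split.
  - move=> c u v _ _; apply: cvg_lim => //.
    rewrite (_ : a _ _ = fun n => c * a u x n + a v x n); last first.
      by apply/funext => n; rewrite /a iterP !ripE.
    by apply: cvgD; [apply: cvgM; [exact: cvg_cst|]|]; exact: aL.
  - by move=> y _; exact: absL.
  by exists z => y; exact: zP.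
have [f fP] := choice ex.
have fl : linear f.
  move=> c x y; apply: rip_ext => z; rewrite ripDr rip_conjZ !fP -limD//.
  congr (limn _); apply/funext => n.
  rewrite -[RHS]/(a (Num.conj c *: z) x n + a z y n) /a iterP ripDr rip_conjZ.
  by rewrite iterZ.
have fb : rbounded f.
  exists 1 => // x; apply: rnorm_le_rip => [|y]; first by rewrite mul1r rnorm_ge0.
  by rewrite ripC fP mul1r.
exists (bop fl fb) => x y; rewrite [bop _ _ _]/= ripC fP /L (_ : a y x = a x y)//.
by apply/funext => n; rewrite /a ripC.
Qed.

End AsymptoticLimit.

Section Alternative.
Context {R : realType}.

(** If [A = 0], then [T] is a contraction; its asymptotic limit is either a
    nonzero operator of the required kind or zero, and then [|T^n h|^2] tends
    to [0]. *)
Lemma dominates_alternative (H : hilbertType R) (T A : 'B(H)) :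
  dominates A T ->
  (exists A : 'B(H), dominating_A T A) \/ (contraction_op T /\ strongly_stable T).
Proof.
move=> TA; have [A0|A0] := pselect (A =1 \0); last first.
  left; exists A; have [? ? ?] := (dominatesP A T).1 TA; by split.
have T1 x : rip (T x) (T x) <= rip x x.
  by have [_ _ _ /(_ x)] := TA; rewrite /dform A0 rip0l; lra.
have [B BP] := asymptotic_limit T1.
have uniq (u : nat -> R) (l l' : R) :
    u n @[n --> \oo] --> l -> u n @[n --> \oo] --> l' -> l = l'.
  by move=> ul ul'; exact: (cvg_unique _ ul ul').
have TB : dominates B T.
  split.
  - move=> x y; apply: uniq (BP x y) _; rewrite ripC.
    under eq_fun do rewrite ripC; exact: BP.
  - move=> x; rewrite -(cvg_lim _ (BP x x))//; apply: limr_ge.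
      by apply/cvg_ex; eexists; exact: BP.
    by apply: nearW => n; exact: rip_ge0.
  - move=> x y; have E : (fun n => rip (iter n T (T x)) (iter n T (T y))) =
        (fun n => rip (iter n.+1 T x) (iter n.+1 T y)).
      by apply/funext => n; rewrite -!iterSr.
    have := BP (T x) (T y); rewrite E => h; apply: uniq h _.
    by have := BP x y; rewrite -(cvg_shiftS (fun n => rip (iter n T x) (iter n T y))).
  - move=> x; apply: (@le_trans _ _ 0); first by rewrite /dform subr_le0.
    rewrite -(cvg_lim _ (BP x x))//; apply: limr_ge.
      by apply/cvg_ex; eexists; exact: BP.
    by apply: nearW => n; exact: rip_ge0.
have [B0|B0] := pselect (B =1 \0); last first.
  left; exists B; have [? ? ?] := (dominatesP B T).1 TB; by split.
right; split=> [x|h]; first by rewrite le_rnorm.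
have := BP h h; rewrite B0 rip0l => /cvgrPdist_le hc.
apply/cvgrPdist_le => _ /gt0_real[e e0 ->].
have [N _ hN] := hc (e ^+ 2) (exprn_gt0 2 e0); exists N => // n /= Nn.
rewrite sub0r normrN normr_id normE lecR.
rewrite -(@ler_pXn2r _ 2)// ?nnegrE ?rnorm_ge0 ?(ltW e0)// rnormE.
by have := hN n Nn; rewrite /= sub0r normrN ger0_norm// rip_ge0.
Qed.

End Alternative.

(** * Orthogonal complements, spans and the matrix condition *)

Section Inclusion.
Context {R : realType}.
Implicit Types H K M : hilbertType R.

Section hincl.
Variables (H : hilbertType R) (U : set H) (hU : closed_subspace U).

Lemma sub_val_bounded : rbounded (@sub_val R H U hU).
Proof. by exists 1 => // x; rewrite mul1r rnorm_le rip_sub. Qed.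

Definition hincl : 'B(hsubspace hU, H) :=
  bop (@sub_val_linear R H U hU) sub_val_bounded.

Lemma incl_isometry : isometry_op hincl.
Proof. by move=> x; apply/eq_rnorm. Qed.

Lemma incl_mem x : U (hincl x).
Proof. by apply/asboolP; exact: sub_valP. Qed.

Lemma inclP x : U x -> exists k, hincl k = x.
Proof. by move=> /asboolP Ux; exists (HSubspace hU Ux). Qed.

Lemma inclK x : U x -> hincl (adj hincl x) = x.
Proof.
by move=> /inclP[k <-]; rewrite (isometry_adjK incl_isometry).
Qed.

End hincl.

Lemma closed_subspace_preimage H K (F : 'B(H, K)) (U : set K) :
  closed_subspace U -> closed_subspace (F @^-1` U).
Proof.
move=> [U0 UD Uc]; split.
- by rewrite /preimage /= linear0.
- by move=> a x y; rewrite /preimage /= linearP; exact: UD.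
- by apply: (continuous_closedP F).1 => //; exact: cts_fun.
Qed.

Lemma closed_subspace1 H : closed_subspace [set (0 : H)].
Proof.
split=> //; first by move=> a x y /= -> ->; rewrite scaler0 addr0.
move=> x /closureP h /=; apply: rnorm_eq0; apply/eqP; rewrite eq_le rnorm_ge0 andbT.
apply/ler_addgt0Pr => e e0; rewrite add0r.
by have [_ -> ] := h e e0; rewrite subr0.
Qed.

Lemma orthc_preimage H K (V : 'B(H, K)) :
  orthc (range V) = adj V @^-1` [set 0].
Proof. by apply/seteqP; split=> x /orthcP. Qed.

Lemma orthc_closed H K (V : 'B(H, K)) : closed_subspace (orthc (range V)).
Proof.
rewrite orthc_preimage; apply: closed_subspace_preimage; exact: closed_subspace1.
Qed.

Lemma closed_span_closed H (A : set H) : closed_subspace (closed_span A).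
Proof.
split.
- by move=> B [[B0 _ _] _].
- move=> a x y Ax Ay B hB; have [[_ BD _] _] := hB.
  by apply: BD; [exact: Ax|exact: Ay].
- move=> x /closureP h B hB; have [[_ _ Bc] _] := hB.
  apply: Bc; apply/closureP => e e0.
  by have [y Ay xy] := h e e0; exists y => //; exact: Ay.
Qed.

Lemma sub_closed_span H (A : set H) : A `<=` closed_span A.
Proof. by move=> x Ax B [_]; exact. Qed.

Lemma closed_span_sub H (A B : set H) :
  closed_subspace B -> A `<=` B -> closed_span A `<=` B.
Proof. by move=> Bc AB x; apply. Qed.

End Inclusion.

Section TypeI.
Context {R : realType}.

(** For a lifting of type I both [Delta W] and [W^* X] vanish, so the matrix
    condition holds trivially. *)
Lemma type_I_matrix_condition (H K : hilbertType R) (V : 'B(H, K)) (T : 'B(H))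
    (S : 'B(K)) :
  two_isometric_lifting V T S -> type_I V S -> matrix_condition V T S.
Proof.
move=> [[Vi VS] S2] tI; pose hO := orthc_closed V.
pose V' := hincl hO; have V'i : isometry_op V' := @incl_isometry R K _ hO.
have VV' a : adj V (V' a) = 0 by apply/orthcP; exact: incl_mem.
have VS' k : adj V (S k) = T (adj V k) by exact: VS.
have V'K k : adj V k = 0 -> V' (adj V' k) = k by move=> /orthcP; exact: inclK.
have V'V h : adj V' (V h) = 0.
  by apply: adj_unique => a; rewrite rip0r ripC adjP VV' rip0r.
pose W := opcomp (adj V') (opcomp S V'); pose X := opcomp (adj V') (opcomp S V).
have WE a : V' (W a) = S (V' a) by rewrite V'K// VS' VV' linear0.
have XE h : V' (X h) = S (V h) - V (T h).
  rewrite -[RHS]V'K; last by rewrite linearB /= VS' !isometry_adjK// subrr.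
  by rewrite linearB /= V'V subr0.
have D0 a k : dform S (V' a) k = 0.
  by rewrite -rip_Delta tI ?rip0l//; exact: incl_mem.
have Wd a : Delta W a = 0.
  apply: rip_ext => b; rewrite rip0r ripC rip_Delta /dform.
  by rewrite -!(isometry_rip V'i) !WE; exact: D0.
have WX g : adj W (X g) = 0.
  apply: adj_unique => a; rewrite rip0r -(isometry_rip V'i) WE XE ripDr ripNr.
  have -> : rip (S (V' a)) (V (T g)) = 0.
    by rewrite ripC adjP VS' VV' linear0 rip0r.
  have := D0 a (V g); rewrite /dform; have -> : rip (V' a) (V g) = 0.
    by rewrite ripC adjP VV' rip0r.
  by rewrite !subr0.
have oV a g : rip (V' a) (V g) = 0 by rewrite ripC adjP VV' rip0r.
exists (hsubspace hO), V', W, X; split.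
- split=> // [x y|m]; first by rewrite innerE -linearZ !oV.
  exists (adj V' (m - V (adj V m))), (adj V m).
  by rewrite V'K ?subrK// linearB /= isometry_adjK// subrr.
- move=> x y; transitivity (S (V' x) + S (V y)); first exact: linearD.
  rewrite -WE -[S (V y)](subrK (V (T y))) -XE addrA; congr (_ + _).
- have X0 : adj X 0 = 0 by apply: adj_unique => g; rewrite !rip0r.
  move=> h; rewrite Wd X0 add0r.
  pose Y := opcomp (adj X) (opcomp (adj W) (opcomp X T)).
  have Y0 g : Y g = 0 by rewrite /Y /= WX X0.
  rewrite -[ReOp _ h]/(2^-1 *: (Y h + adj Y h)) Y0 add0r.
  suff -> : adj Y h = 0 by rewrite !scaler0.
  by apply: adj_unique => g; rewrite Y0 rip0l rip0r.
Qed.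

End TypeI.

(** * Minimal liftings of type I *)

Section Shift.
Context {R : realType}.
Variable H : hilbertType R.

Let cons_seq (h : H) (f : nat -> H) (n : nat) : H :=
  if n is m.+1 then f m else h.

Let psum_cons h f h' f' N :
  psum (cons_seq h f) (cons_seq h' f') N.+1 = rip h h' + psum f f' N.
Proof. by rewrite /psum big_ord_recl. Qed.

Let cons_l2 h (f : ell2 H) : `[< l2 (cons_seq h f) >].
Proof.
apply/asboolP; exists (rip h h + rip f f) => -[|N].
  by rewrite /psum big_ord0 addr_ge0 ?rip_ge0.
by rewrite psum_cons lerD2l psum_le_rip.
Qed.

Let ell_cons h f : ell2 H := Ell2 (cons_l2 h f).

Let rip_cons h f h' f' :
  rip (ell_cons h f) (ell_cons h' f') = rip h h' + rip f f'.
Proof.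
rewrite !rip_ell; apply: cvg_lim => //.
rewrite -(cvg_shiftS (psum _ _)) /=.
under eq_fun do rewrite psum_cons.
by apply: cvgD; [exact: cvg_cst|exact/psum_cvg/ell_l2/ell_l2].
Qed.

Let tail_l2 (f : ell2 H) : `[< l2 (fun n => f n.+1) >].
Proof.
apply/asboolP; exists (rip f f) => N; apply: le_trans (psum_le_rip f N.+1).
by rewrite /psum big_ord_recl lerDr rip_ge0.
Qed.

Let cons_head_tail (f : ell2 H) : f = ell_cons (f 0%N) (Ell2 (tail_l2 f)).
Proof. by apply: ellP => -[]. Qed.

Let V0 h := ell_cons h 0.
Let V1 f := ell_cons 0 f.

Let V0_linear : linear V0.
Proof.
move=> a x y; apply: ellP => -[//|n].
by rewrite -[RHS]/(a *: (0 : H) + 0) scaler0 addr0.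
Qed.

Let V1_linear : linear V1.
Proof.
move=> a x y; apply: ellP => -[|n //].
by rewrite -[RHS]/(a *: (0 : H) + 0) scaler0 addr0.
Qed.

Let V0_rip x : rip (V0 x) (V0 x) = rip x x.
Proof. by rewrite rip_cons rip0l addr0. Qed.

Let V1_rip f : rip (V1 f) (V1 f) = rip f f.
Proof. by rewrite rip_cons rip0l add0r. Qed.

Let isometric_bounded (K L : hilbertType R) (F : K -> L) :
  (forall x, rip (F x) (F x) = rip x x) -> rbounded F.
Proof. by move=> h; exists 1 => // x; rewrite mul1r rnorm_le h. Qed.

(** [l2(H)] absorbs a copy of [H] through the unilateral shift. *)
Lemma ell2_shift :
  exists (W0 : 'B(H, ell2 H)) (W1 : 'B(ell2 H)), orth_decomp W0 W1.
Proof.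
exists (bop V0_linear (isometric_bounded V0_rip)),
  (bop V1_linear (isometric_bounded V1_rip)); split.
- by move=> x; apply/eq_rnorm/V0_rip.
- by move=> x; apply/eq_rnorm/V1_rip.
- have o x f : rip (V0 x) (V1 f) = 0 by rewrite rip_cons rip0l rip0r addr0.
  move=> x f; rewrite innerE -linearZ; congr (_ +i* _); exact: o.
- move=> f; exists (f 0%N), (Ell2 (tail_l2 f)).
  rewrite [LHS]cons_head_tail; apply: ellP => -[|n].
    by rewrite -[RHS]/(f 0%N + 0) addr0.
  by rewrite -[RHS]/(0 + f n.+1) add0r.
Qed.

End Shift.

Section Lifting.
Context {R : realType}.

(** Both norms are suprema of the same set of numbers. *)
Lemma op_norm_conj (H K : hilbertType R) (V : 'B(H, K)) (A : 'B(H)) (B : K -> K) :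
  isometry_op V -> (forall k, B k = V (A (adj V k))) -> op_norm B = op_norm A.
Proof.
move=> Vi BE; rewrite /op_norm; congr sup; apply/seteqP; split=> _ [x /= x1 <-].
  exists (adj V x) => /=; last by rewrite BE Vi.
  apply: le_trans x1; rewrite le_rnorm; exact: isometry_adj_le.
by exists (V x) => /=; [rewrite Vi|rewrite BE Vi isometry_adjK].
Qed.

Variables (H : hilbertType R) (T A : 'B(H)).
Hypothesis TA : dominates A T.

(** Adding the shift below [T], fed by a square root [X] of [A - Delta T],
    raises [Delta T] to [A] on [H] and to [0] on the complement. *)
Lemma dominates_dilation : exists (M : hilbertType R) (V : 'B(H, M)) (S : 'B(M)),
  [/\ isometry_op V, forall m, adj V (S m) = T (adj V m) &
      forall m m', dform S m m' = rip (A (adj V m)) (adj V m')].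
Proof.
have [As A0 AT TleA] := TA.
pose B := oplin 1 (-1) A (DeltaB T).
have BE x y : rip (B x) y = rip (A x) y - dform T x y.
  by rewrite /B oplinB ripDl ripNl -DeltaBE rip_Delta.
have [|X XE] := @positive_factor R H B.
  apply/positive_op; split=> [x y|x]; last by rewrite BE subr_ge0.
  by rewrite BE (ripC x) BE As (ripC x) dformC.
have [V [V1 hV]] := ell2_shift H; have [Vi V1i _ _] := hV.
pose S := oplin 1 1 (opcomp (oplin 1 1 (opcomp V T) (opcomp V1 (opcomp V X))) (adj V))
                    (opcomp V1 (opcomp V1 (adj V1))).
have SE m : S m = V (T (adj V m)) + V1 (V (X (adj V m)) + V1 (adj V1 m)).
  rewrite /S [LHS]/= !scale1r linearD addrA; congr (_ + _ + _).
exists (ell2 H), V, S; split=> // [m|m m'].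
  rewrite SE.
  by have [] := orth_decomp_adj hV (T (adj V m)) (V (X (adj V m)) + V1 (adj V1 m)).
rewrite /dform !SE !(orth_decomp_rip hV) XE BE /dform.
have -> : rip m m' = rip (adj V m) (adj V m') + rip (adj V1 m) (adj V1 m').
  by rewrite -(orth_decomp_rip hV) !(orth_decompE hV).
by ring.
Qed.

(** Compressing the dilation to the closed span of the orbit of [H] makes it
    minimal and keeps [Delta S = V A V^*]. *)
Lemma dominates_minimal_lifting :
  exists (K : hilbertType R) (V : 'B(H, K)) (S : 'B(K)),
    [/\ two_isometric_lifting V T S, type_I V S, matrix_condition V T S,
        minimal_lifting V S & op_norm (Delta S) = op_norm A].
Proof.
have [As A0 AT TleA] := TA.
have [M [V0 [S0 [V0i VS0 dS0]]]] := dominates_dilation.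
pose G := [set iter n S0 (V0 h) | n in [set: nat] & h in [set: H]].
pose hU := closed_span_closed G.
pose i := hincl hU; have ii : isometry_op i := @incl_isometry R M _ hU.
have UV h : closed_span G (V0 h) by apply: sub_closed_span; exists 0%N => //; exists h.
have US m : closed_span G m -> closed_span G (S0 m).
  apply: (@closed_span_sub R M G (S0 @^-1` closed_span G)).
    exact: closed_subspace_preimage.
  move=> _ [n _ [h _ <-]]; apply: sub_closed_span; exists n.+1 => //; exists h => //.
pose V := opcomp (adj i) V0; pose S := opcomp (adj i) (opcomp S0 i).
have iV h : i (V h) = V0 h by apply: inclK.
have iS k : i (S k) = S0 (i k) by apply: inclK; apply: US; exact: incl_mem.
have Vi : isometry_op V.
  by move=> x; apply/eq_rnorm; rewrite -!(isometry_rip ii) !iV (isometry_rip V0i).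
have adjV k : adj V k = adj V0 (i k).
  by apply: adj_unique => h; rewrite -adjP -(isometry_rip ii) iV.
have dS k k' : dform S k k' = rip (A (adj V k)) (adj V k').
  by rewrite !adjV -dS0 /dform -!(isometry_rip ii) !iS.
have VS k : adj V (S k) = T (adj V k) by rewrite !adjV iS VS0.
have lift : two_isometric_lifting V T S.
  split; first by split.
  by apply/two_isometryP => x y; rewrite !dS !VS AT.
have DeltaE k : Delta S k = V (A (adj V k)).
  by apply: rip_ext => k'; rewrite ripC rip_Delta dS adjP' ripC.
have tI : type_I V S.
  by move=> k /orthcP Vk; apply: etrans (DeltaE k) _; rewrite Vk !linear0.
exists (hsubspace hU), V, S; split=> //.
- exact: type_I_matrix_condition lift tI.
- rewrite /minimal_lifting; apply/seteqP; split=> // k _.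
  set G' := [set _ | _ in _ & _ in _].
  have iterE n h : i (iter n S (V h)) = iter n S0 (V0 h).
    by elim: n => [|n IH]; rewrite ?iV// !iterS iS IH.
  have [U'0 U'D U'c] := closed_span_closed G'.
  have : closed_span G (i k) by exact: incl_mem.
  (* As [i] is isometric, the closed span in [K] has a closed image; containing
     the orbit, this image is all of the closed span in [M]. *)
  have img : closed_subspace (i @` closed_span G').
    split.
    + by exists 0 => //; rewrite linear0.
    + move=> a _ _ [x Ux <-] [y Uy <-]; exists (a *: x + y); last by rewrite linearP.
      exact: U'D.
    + move=> m /closureP h.
      have Um : closed_span G m.
        have [_ _ Uc] := hU; apply: Uc; apply/closureP => e e0.
        by have [_ [x _ <-] mx] := h e e0; exists (i x) => //; exact: incl_mem.
      exists (adj i m); last exact: inclK.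
      apply: U'c; apply/closureP => e e0; have [_ [x Ux <-] mx] := h e e0.
      have ix : i (adj i m - x) = m - i x.
        by rewrite linearB; congr (_ - _); exact: inclK.
      by exists x => //; apply: le_trans mx; rewrite rnorm_le -(isometry_rip ii) ix.
  move=> /(closed_span_sub img) [|x Ux ix].
    move=> _ [n _ [h _ <-]]; exists (iter n S (V h)); last exact: iterE.
    by apply: sub_closed_span; exists n => //; exists h.
  by rewrite -(isometry_adjK ii k) -ix (isometry_adjK ii).
- exact: op_norm_conj Vi DeltaE.
Qed.

End Lifting.

(** * Unitary extensions of partial isometries *)

Section UnitaryExtension.
Context {R : realType}.
Implicit Types H K L N M : hilbertType R.

(** When the norms agree, the factor is isometric on the closed range of [P],
    where its adjoint inverts it. *)
Lemma douglas_isometric H K L (P : 'B(H, K)) (Q : 'B(H, L)) :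
  (forall x, rip (Q x) (Q x) = rip (P x) (P x)) ->
  exists G : 'B(K, L), [/\ forall x, G (P x) = Q x,
    forall k, rip (G k) (G k) <= rip k k,
    forall k, closure (range P) k -> adj G (G k) = k &
    forall l, closure (range P) (adj G l)].
Proof.
move=> QP; have [|G [GP G1 Gr]] := @douglas R H K L P Q.
  by move=> x; rewrite QP.
exists G; split=> //; apply: adj_fixed_closure => _ [x _ <-].
by apply: contraction_isometric_at => //; rewrite GP QP.
Qed.

Lemma isometric_onto_unitary H (U : 'B(H)) :
  (forall x, rip (U x) (U x) = rip x x) -> (forall y, exists x, U x = y) ->
  unitary_op U.
Proof.
move=> Ui Uo; have Uiso : isometry_op U by move=> x; apply/eq_rnorm/Ui.
have UK := isometry_adjK Uiso; split=> [x|y] /=; first exact: UK.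
by have [x <-] := Uo y; rewrite UK.
Qed.

Definition opadd H K (S T : 'B(H, K)) : 'B(H, K) := oplin 1 1 S T.

Lemma opaddE H K (S T : 'B(H, K)) x : opadd S T x = S x + T x.
Proof. by rewrite [LHS]/= !scale1r. Qed.

Lemma opcompE H K L (S : 'B(K, L)) (T : 'B(H, K)) x : opcomp S T x = S (T x).
Proof. by []. Qed.

Lemma opD H K (T : 'B(H, K)) x y : T (x + y) = T x + T y.
Proof. exact: linearD. Qed.

Lemma opB H K (T : 'B(H, K)) x y : T (x - y) = T x - T y.
Proof. exact: linearB. Qed.

Lemma op0 H K (T : 'B(H, K)) : T 0 = 0.
Proof. exact: linear0. Qed.

Lemma adjB H K (T : 'B(H, K)) x y : adj T (x - y) = adj T x - adj T y.
Proof. exact: (linearB (adj T : 'B(K, H))). Qed.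

Lemma adj0 H K (T : 'B(H, K)) : adj T 0 = 0.
Proof. exact: (linear0 (adj T : 'B(K, H))). Qed.

Section Julia.
Variables (H : hilbertType R) (W : 'B(H)).
Hypothesis WW : forall x, adj W (W (adj W x)) = adj W x.

Let D := oplin 1 (-1) (op1 H) (opcomp (adj W) W).
Let D' := oplin 1 (-1) (op1 H) (opcomp W (adj W)).

Let DE x : D x = x - adj W (W x). Proof. exact: oplinB. Qed.
Let D'E x : D' x = x - W (adj W x). Proof. exact: oplinB. Qed.

Let WWW x : W (adj W (W x)) = W x.
Proof. by apply: rip_ext => y; rewrite adjP' -adjP adjP' WW -adjP'. Qed.

(** The two rows of the Julia operator of a partial isometry. *)
Let j0 x y := W x + D' y.
Let j1 x y := D x - adj W y.

Let julia_rip x y : rip (j0 x y) (j0 x y) + rip (j1 x y) (j1 x y) =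
  rip x x + rip y y.
Proof.
rewrite /j0 /j1 rip_add_sqr rip_sub_sqr.
have -> : rip (W x) (D' y) = 0.
  by rewrite D'E ripDr ripNr (adjP' W (adj W y)) -adjP WWW subrr.
have -> : rip (D x) (adj W y) = 0.
  by rewrite -adjP DE linearB /= WWW subrr rip0l.
have -> : rip (D x) (D x) = rip x x - rip (W x) (W x).
  rewrite DE rip_sub_sqr -!(adjP W) WWW; ring.
have -> : rip (D' y) (D' y) = rip y y - rip (adj W y) (adj W y).
  rewrite D'E rip_sub_sqr !(adjP' W) WW; ring.
ring.
Qed.

Let julia_onto p q : exists x y, j0 x y = p /\ j1 x y = q.
Proof.
have WD z : W (D z) = 0 by rewrite DE linearB /= WWW subrr.
have D'W z : D' (W z) = 0 by rewrite D'E WWW subrr.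
have WD' z : adj W (D' z) = 0 by rewrite D'E linearB /= WW subrr.
have DW z : D (adj W z) = 0 by rewrite DE WW subrr.
exists (adj W p + D q), (D' p - W q); rewrite /j0 /j1; split.
  rewrite opD opB WD D'W addr0 subr0 (D'E (D' p)) WD'.
  by rewrite op0 subr0 D'E subrKC.
rewrite opD adjB DW WD' add0r sub0r opprK (DE (D q)) WD.
by rewrite adj0 subr0 DE subrK.
Qed.

(** The Julia operator completes [W] to a unitary operator once its second output
    is moved to an outgoing shift and its second input comes from an incoming
    backward shift. The decompositions [N = H + N] and [M = N + M] present a vector
    of [M] as a sequence in [N], and a vector of [N] as a sequence in [H]. The head
    of the first entry carries the input of [W], the second entry is the incoming
    sequence, the third the outgoing one, and all other components are left
    fixed. *)
Lemma unitary_extension (N M : hilbertType R) (V0 : 'B(H, N)) (V1 : 'B(N))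
    (W0 : 'B(N, M)) (W1 : 'B(M)) :
  orth_decomp V0 V1 -> orth_decomp W0 W1 ->
  exists U : 'B(M), unitary_op U /\
    forall h, adj W (W h) = h -> U (W0 (V0 h)) = W0 (V0 (W h)).
Proof.
move=> hV hW.
have VA x y := orth_decomp_adj hV x y; have WA x y := orth_decomp_adj hW x y.
pose a := adj W0 : 'B(M, N). 
pose b := opcomp (adj W0) (adj W1).
pose c := opcomp (adj W0) (opcomp (adj W1) (adj W1)).
pose r := opcomp (adj W1) (opcomp (adj W1) (adj W1)).
pose x := opcomp (adj V0) a; pose y := opcomp (adj V0) b.
pose U := opadd (opcomp W0 (opadd (opcomp V0 (opadd (opcomp W x) (opcomp D' y)))
                                  (opcomp V1 (opcomp (adj V1) a))))
  (opcomp W1 (opadd (opcomp W0 (opcomp (adj V1) b))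
    (opcomp W1 (opadd (opcomp W0
        (opadd (opcomp V0 (oplin 1 (-1) (opcomp D x) (opcomp (adj W) y)))
               (opcomp V1 c)))
      (opcomp W1 r))))).
have UE F : U F = W0 (V0 (j0 (x F) (y F)) + V1 (adj V1 (a F))) +
    W1 (W0 (adj V1 (b F)) +
        W1 (W0 (V0 (j1 (x F) (y F)) + V1 (c F)) + W1 (r F))).
  by rewrite /U !(opaddE, opcompE) (oplinB (opcomp D x) (opcomp (adj W) y)).
have xE F : V0 (x F) + V1 (adj V1 (a F)) = a F by exact: (orth_decompE hV).
have yE F : V0 (y F) + V1 (adj V1 (b F)) = b F by exact: (orth_decompE hV).
have dec F : W0 (a F) + W1 (W0 (b F) + W1 (W0 (c F) + W1 (r F))) = F.
  rewrite -[RHS](orth_decompE hW F); congr (W0 _ + W1 _).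
  rewrite -[RHS](orth_decompE hW (adj W1 F)); congr (W0 _ + W1 _).
  exact: (orth_decompE hW).
have Uval p p' q q' c' r' :
    U (W0 (V0 p + V1 p') + W1 (W0 (V0 q + V1 q') + W1 (W0 c' + W1 r'))) =
    W0 (V0 (j0 p q) + V1 p') +
    W1 (W0 q' + W1 (W0 (V0 (j1 p q) + V1 c') + W1 r')).
  pose m2 := W0 c' + W1 r'; pose m1 := W0 (V0 q + V1 q') + W1 m2.
  pose F := W0 (V0 p + V1 p') + W1 m1; rewrite -[X in U X]/F UE.
  have [aF F1] : a F = V0 p + V1 p' /\ adj W1 F = m1 by exact: (WA (V0 p + V1 p') m1).
  have [bF F2] : b F = V0 q + V1 q' /\ adj W1 (adj W1 F) = m2.
    by have := WA (V0 q + V1 q') m2; rewrite -/m1 -F1.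
  have [cF rF] : c F = c' /\ r F = r'.
    by have := WA c' r'; rewrite -/m2 -F2.
  have xF : x F = p by rewrite [x F]/(adj V0 (a F)) aF; have [] := VA p p'.
  have yF : y F = q by rewrite [y F]/(adj V0 (b F)) bF; have [] := VA q q'.
  rewrite aF bF cF rF xF yF.
  by have [_ ->] := VA p p'; have [_ ->] := VA q q'.
exists U; split.
  apply: isometric_onto_unitary => [F|G].
    have FF : rip F F = rip (a F) (a F) +
        (rip (b F) (b F) + (rip (c F) (c F) + rip (r F) (r F))).
      by rewrite -{1 2}(dec F) !(orth_decomp_rip hW).
    have aa : rip (a F) (a F) =
        rip (x F) (x F) + rip (adj V1 (a F)) (adj V1 (a F)).
      by rewrite -{1 2}(xE F) (orth_decomp_rip hV).
    have bb : rip (b F) (b F) =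
        rip (y F) (y F) + rip (adj V1 (b F)) (adj V1 (b F)).
      by rewrite -{1 2}(yE F) (orth_decomp_rip hV).
    rewrite UE FF aa bb !(orth_decomp_rip hW) !(orth_decomp_rip hV).
    have := julia_rip (x F) (y F); lra.
  have [h [g [jh jg]]] := julia_onto (x G) (adj V0 (c G)).
  exists (W0 (V0 h + V1 (adj V1 (a G))) +
    W1 (W0 (V0 g + V1 (b G)) + W1 (W0 (adj V1 (c G)) + W1 (r G)))).
  by rewrite Uval jh jg xE (orth_decompE hV) dec.
move=> h Wh; have := Uval h 0 0 0 0 0.
have -> : j0 h 0 = W h by rewrite /j0 linear0 addr0.
have -> : j1 h 0 = 0 by rewrite /j1 linear0 subr0 DE Wh subrr.
by rewrite !(linear0, addr0).
Qed.

End Julia.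
End UnitaryExtension.

(** * From dominating operators to triangular extensions *)

Section Extension.
Context {R : realType}.

Lemma isometry_on_closure (E K L : hilbertType R) (P : 'B(E, K)) (J : 'B(K, L)) :
  (forall k, closure (range P) k -> adj J (J k) = k) ->
  isometry_on (closure (range P)) J.
Proof.
move=> JK; split=> [a x y _ _|x Dx]; first exact: opL.
by apply/eq_rnorm; rewrite adjP JK.
Qed.

(** A square root [F] of [I - G^* G] provides the coupling. From
    [|F W0 x| = |D_C x|] and [|F W1 y| = |D_E y|] come the isometries
    [J0 D_C = F W0] and [J1 D_E = F W1], and the off-diagonal entry of [F^* F] is
    [- C^* E] because the ranges of [W0] and [W1] are orthogonal. *)
Lemma row_contraction_coupling (M0 M1 M N : hilbertType R) (W0 : 'B(M0, M))
    (W1 : 'B(M1, M)) (G : 'B(M, N)) :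
  orth_decomp W0 W1 -> (forall m, rip (G m) (G m) <= rip m m) ->
  let C := opcomp G W0 in let E := opcomp G W1 in
  [/\ contraction_op C, contraction_op E &
    exists (M' : hilbertType R) (J0 : M0 -> M') (J1 : M1 -> M'),
    [/\ isometry_on (defect_space C) J0, isometry_on (defect_space E) J1
      & forall y, defect_op C (adj_on (defect_space C) J0 (J1 (defect_op E y)))
                  + adj C (E y) = 0]].
Proof.
move=> hW G1 C E; have [W0i W1i W01 _] := hW.
have C1 : contraction_op C.
  by move=> x; rewrite le_rnorm -(isometry_rip W0i x x) G1.
have E1 : contraction_op E.
  by move=> x; rewrite le_rnorm -(isometry_rip W1i x x) G1.
split=> //.
pose B := oplin 1 (-1) (op1 M) (opcomp (adj G) G).
have BE x y : rip (B x) y = rip x y - rip (G x) (G y).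
  by rewrite /B oplinB ripDl ripNl -(adjP' G).
have [|F FE] := @positive_factor R M B.
  apply/positive_op; split=> [x y|x]; last by rewrite BE subr_ge0.
  by rewrite BE (ripC x (B y)) BE (ripC y) (ripC (G y)).
have [DC [DCE DCs DCr]] := defect_opP C1; have [DE [DEE DEs DEr]] := defect_opP E1.
have [|J0 [J0E _ J0K _]] := @douglas_isometric R _ _ _ DC (opcomp F W0).
  by move=> x; rewrite DCr FE BE (isometry_rip W0i).
have [|J1 [J1E _ J1K _]] := @douglas_isometric R _ _ _ DE (opcomp F W1).
  by move=> x; rewrite DEr FE BE (isometry_rip W1i).
have J0i : isometry_on (defect_space C) J0.
  by rewrite /defect_space DCE; exact: isometry_on_closure.
exists M, J0, J1; split=> //.
  by rewrite /defect_space DEE; exact: isometry_on_closure.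
move=> y; rewrite DCE DEE; apply: rip_ext => x; rewrite rip0r ripDr -DCs -adjP.
have J01 u : defect_space C u -> rnorm (J0 u) <= 1 * rnorm u.
  by move=> Du; rewrite mul1r rnorm_le (isometry_on_rip J0i Du).
have [_ zP] := @adj_onP R _ _ (defect_space C) J0 1 (J1 (DE y))
  (defect_space_closed C1) ler01 J0i.1 J01.
rewrite -zP; last by rewrite /defect_space DCE; apply: subset_closure; exists x.
rewrite J0E J1E FE BE subrK.
by rewrite /rip W01.
Qed.

(** The space is [M0 (+) M1] with [M0 = l2(H)] and [M1 = l2(l2(H))], which is large
    enough for the unitary extension; [H] enters [M0] through [V0] and [M1] through
    [J]. *)
Lemma dominates_triangular (H : hilbertType R) (T A : 'B(H)) :
  dominates A T -> exists delta, triangular_extension T delta.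
Proof.
move=> [As A0 AT TA]; have [c c0 Ac] := op_bounded A.
(* [|A| <= c] implies [A <= d^2] for this [d]. *)
pose d := c + 1; have d0 : 0 < d by rewrite addr_gt0.
have d20 : 0 < d ^+ 2 by rewrite exprn_gt0.
have d2N : d ^+ 2 != 0 by rewrite gt_eqF.
exists d.
pose a := oplin (d ^+ 2)^-1 0 A A.
have aE x y : rip (a x) y = (d ^+ 2)^-1 * rip (A x) y by rewrite /a oplinZ ripZl.
have [|Y YE] := @positive_factor R H a.
  apply/positive_op; split=> [x y|x]; last by rewrite aE mulr_ge0// invr_ge0 ltW.
  by rewrite aE (ripC x) aE As (ripC x).
have YA x y : rip (A x) y = d ^+ 2 * rip (Y x) (Y y).
  by rewrite YE aE mulrA divff// mul1r.
have Y1 x : rip (Y x) (Y x) <= rip x x.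
  rewrite YE aE mulrC ler_pdivrMr//.
  apply: (@le_trans _ _ (c * rip x x)).
    apply: le_trans (ler_norm _) (le_trans (rip_le _ _) _).
    by rewrite -rnormE expr2 mulrA ler_wpM2r ?rnorm_ge0.
  by rewrite mulrC ler_wpM2l ?rip_ge0// /d; nra.
pose b := oplin 1 (-1) (op1 H) (opcomp (adj Y) Y).
have bE x y : rip (b x) y = rip x y - rip (Y x) (Y y).
  by rewrite /b oplinB ripDl ripNl -(adjP' Y).
have [|X XE] := @positive_factor R H b.
  apply/positive_op; split=> [x y|x]; last by rewrite bE subr_ge0.
  by rewrite bE (ripC x (b y)) bE (ripC y) (ripC (Y y)).
have YT x : rip (Y (T x)) (Y (T x)) = rip (Y x) (Y x).
  by rewrite !YE !aE AT.
have [|W [WE W1 WK Wr]] := @douglas_isometric R H H H Y (opcomp Y T).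
  by move=> x; rewrite opcompE YT.
have WW x : adj W (W (adj W x)) = adj W x by exact: WK.
have [V0 [V1 hV]] := ell2_shift H; have [V0i _ _ _] := hV.
have [Z0 [Z1 hZ]] := ell2_shift (ell2 H); have [Z0i Z1i _ _] := hZ.
have [U [Uu UW]] := unitary_extension WW hV hZ.
have UY h : U (Z0 (V0 (Y h))) = Z0 (V0 (Y (T h))).
  by rewrite UW; [rewrite WE|apply: WK; apply: subset_closure; exists h].
pose J := opcomp Z0 V0.
have Jr x y : rip (J x) (J y) = rip x y.
  by rewrite (isometry_rip Z0i) (isometry_rip V0i).
pose Z1JY := opcomp Z1 (opcomp J Y).
pose P := opadd (opcomp Z0 (opcomp V0 X)) (oplin d 0 Z1JY Z1JY).
have PE h : P h = Z0 (V0 (X h)) + Z1 (d%:C *: J (Y h)).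
  by rewrite /P opaddE oplinZ !opcompE [Z1 (_ *: _)]linearZ.
have [|G [GP G1 _]] := @douglas R H _ _ P (opcomp V0 (opcomp X T)).
  move=> h; rewrite PE (orth_decomp_rip hZ) !opcompE !(isometry_rip V0i) !ripE Jr.
  rewrite !XE !bE YT; have := TA h; rewrite YA /dform expr2; lra.
have [C1 E1 coupling] := row_contraction_coupling hZ G1.
pose C := opcomp G Z0; pose E := opcomp G Z1.
pose V := opadd (opcomp Z0 (opcomp V0 X)) (opcomp Z1 (opcomp J Y)).
have VE h : V h = Z0 (V0 (X h)) + Z1 (J (Y h)) by rewrite /V opaddE.
pose EZ1 := opcomp E (adj Z1).
pose T' := opadd (opcomp Z0 (opadd (opcomp C (adj Z0)) (oplin d 0 EZ1 EZ1)))
  (opcomp Z1 (opcomp U (adj Z1))).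
have T'E x y : T' (Z0 x + Z1 y) = Z0 (C x + d%:C *: E y) + Z1 (U y).
  have -> m : T' m = Z0 (C (adj Z0 m) + d%:C *: E (adj Z1 m)) + Z1 (U (adj Z1 m)).
    by rewrite /T' opaddE !opcompE opaddE oplinZ.
  by have [-> ->] := orth_decomp_adj hZ x y.
exists _, _, _, V, T', Z0, Z1, C, E, U; split=> //; split.
  move=> h; apply/eq_rnorm; rewrite VE (orth_decomp_rip hZ) Jr (isometry_rip V0i).
  by rewrite XE bE subrK.
move=> h; rewrite -[LHS]/(T' (V h)) -[RHS]/(V (T h)) !VE T'E UY; congr (Z0 _ + _).
have <- : G (P h) = V0 (X (T h)) by rewrite GP.
by rewrite PE opD [Z1 (_ *: _)]linearZ [G (_ *: _)]linearZ.
Qed.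

End Extension.

Theorem theorem3p2 (R : realType) (H : hilbertType R) (T : 'B(H)) :
  [<->
    exists (K : hilbertType R) (V : 'B(H, K)) (S : 'B(K)),
      two_isometric_lifting V T S /\ type_I V S;
    (exists A : 'B(H), dominating_A T A)
      \/ (contraction_op T /\ strongly_stable T);
    exists delta : R, triangular_extension T delta;
    exists (K : hilbertType R) (V : 'B(H, K)) (S : 'B(K)),
      two_isometric_lifting V T S /\ matrix_condition V T S ]
  /\ (forall A : 'B(H), dominating_A T A ->
      exists (K : hilbertType R) (V : 'B(H, K)) (S : 'B(K)),
        [/\ two_isometric_lifting V T S, type_I V S, matrix_condition V T S,
            minimal_lifting V S & cov S = Num.sqrt (op_norm A)])
  /\ (forall delta : R, triangular_extension T delta ->
      exists (K : hilbertType R) (V : 'B(H, K)) (S : 'B(K)),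
        [/\ two_isometric_lifting V T S, type_I V S, matrix_condition V T S,
            minimal_lifting V S & (cov S <= delta)%R]).
Proof.
have dominating A : dominating_A T A -> dominates A T.
  by move=> [? ? ? ?]; apply/dominatesP.
have from_triangular delta : triangular_extension T delta ->
    exists (K : hilbertType R) (V : 'B(H, K)) (S : 'B(K)),
        [/\ two_isometric_lifting V T S, type_I V S, matrix_condition V T S,
            minimal_lifting V S & (cov S <= delta)%R].
  move=> /triangular_dominates[d0 [A [TA Ad]]].
  have [K [V [S [lift tI mc minl nE]]]] := dominates_minimal_lifting TA.
  exists K, V, S; split=> //.
  rewrite /cov nE -(ger0_norm (ltW d0)) -sqrtr_sqr ler_wsqrtr//.
split; [|split=> // A TA].
  tfae.
  - move=> [K [V [S [lift tI]]]].
    exact: dominates_alternative (type_I_dominates lift tI).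
  - move=> [[A /dominating]|[T1 _]]; first exact: dominates_triangular.
    apply: (@dominates_triangular _ _ T (oplin 0 0 T T)).
    have O x : oplin 0 0 T T x = 0 by rewrite oplinZ scale0r.
    split=> [x y|x|x y|x]; rewrite ?O ?rip0l ?rip0r//.
    by rewrite /dform subr_le0 -le_rnorm.
  - move=> [delta /from_triangular[K [V [S [lift _ mc _ _]]]]].
    by exists K, V, S.
  - move=> [K [V [S [lift mc]]]].
    have [K' [V' [S' [lift' tI' _ _ _]]]] :=
      dominates_minimal_lifting (matrix_condition_dominates lift mc).
    by exists K', V', S'.
have [K [V [S [lift tI mc minl nE]]]] := dominates_minimal_lifting (dominating A TA).
by exists K, V, S; split=> //; rewrite /cov nE.
Qed.
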